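(* Assume the empirical CLT holds over $\mathcal{C}$ with limit $\{G(t,x):(t,x)\in E\times\mathbb{R}\}$, and that for every $t\in E$ the distribution function $F(t,\cdot)$ is strictly increasing and has a density $f(t,\cdot)$, where these densities satisfy $$\lim_{\delta\to 0}\ \sup_{t\in E}\ \sup_{|u-v|\le\delta}|f(t,u)-f(t,v)|=0,$$ and for every closed interval $I$ in $(0,1)$ there is $\theta(I)>0$ such that $$\inf_{t\in E,\ \alpha\in I,\ |x-\tau_\alpha(t)|\le\theta(I)} f(t,x)>0 .$$ Then, for $I$ a closed subinterval of $(0,1)$, $$\Big(\sup_{t\in E,\alpha\in I}\big|\sqrt n\,(\widehat\tau^n_\alpha(t)-\tau_\alpha(t))\,f(t,\tau_\alpha(t))+\widehat G(t,\tau_\alpha(t))\big|\Big)^{*}\longrightarrow 0$$ in $\widehat P$-probability, and therefore the quantile processes $\{\sqrt n(\widehat\tau^n_\alpha(t)-\tau_\alpha(t))f(t,\tau_\alpha(t)):n\ge1\}$ satisfy the CLT in $\ell_\infty(E\times I)$ with Gaussian limit process $\{\widehat G(t,\tau_\alpha(t)):(t,\alpha)\in E\times I\}$. Moreover, the quantile processes $\{\sqrt n(\widehat\tau^n_\alpha(t)-\tau_\alpha(t)):n\ge1\}$ also satisfy the CLT in $\ell_\infty(E\times I)$ with Gaussian limit process $\{\widehat G(t,\tau_\alpha(t))/f(t,\tau_\alpha(t)):(t,\alpha)\in E\times I\}$.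
   Context: $E$ is a set, $D(E)$ is a collection of real-valued functions on $E$, and $X=\{X(t):t\in E\}$ is a stochastic process with $P(X(\cdot)\in D(E))=1$. $X_1,X_2,\dots$ are i.i.d. copies of $X$. Put $F(t,x)=F_t(x)=P(X(t)\le x)$, $F_n(t,x)=F_{n,t}(x)=\frac1n\sum_{i=1}^n I(X_i(t)\le x)$, $\nu_n(t,x)=\sqrt n(F_n(t,x)-F(t,x))$, $C_{t,x}=\{z\in D(E):z(t)\le x\}$, $\mathcal C=\{C_{t,x}:t\in E,x\in\mathbb R\}$ (identified with $E\times\mathbb R$). $\ell_\infty(S)$ is the space of bounded real functions on $S$ with the sup-norm. ''The (empirical) CLT holds over $\mathcal C$ with limit $G$'' means: there is a centered Gaussian process $G=\{G(t,x)\}$ on $E\times\mathbb R$ with covariance $E(G(s,x)G(t,y))=P(X(s)\le x,X(t)\le y)-F(s,x)F(t,y)$ whose law on $\ell_\infty(E\times\mathbb R)$ is Radon, equivalently whose sample paths are bounded and uniformly continuous with respect to its $L_2$-distance $d((s,x),(t,y))=(E[(G(s,x)-G(t,y))^2])^{1/2}$, and $\lim_n E^*h(\nu_n)=E\,h(G)$ for every bounded continuous $h:\ell_\infty(E\times\mathbb R)\to\mathbb R$, where $E^*$ is upper expectation. $G$ always denotes the version with bounded $d$-uniformly continuous paths. In general, processes $V_n$ indexed by a set $S$ satisfy the CLT in $\ell_\infty(S)$ with Gaussian limit $V$ if $V$ is a centered Gaussian process with Radon law on $\ell_\infty(S)$ and $E^*h(V_n)\to E\,h(V)$ for every bounded continuous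 $h:\ell_\infty(S)\to\mathbb R$. For a (possibly nonmeasurable) function $f$ with values in $[-\infty,\infty]$ on a probability space, $f^*$ denotes its measurable cover function. Almost sure representation: let $(\Omega,\mathcal A,Q)$ be the probability space carrying the $X_j$ and $G$. When the CLT holds over $\mathcal C$, there are a probability space $(\widehat\Omega,\widehat{\mathcal F},\widehat P)$ and perfect measurable maps $g_n:\widehat\Omega\to\Omega$, $n\ge0$ (perfect: $(h\circ g_n)^*=h^*\circ g_n$ a.s. for bounded real $h$ on $\Omega$), with $\widehat P\circ g_n^{-1}=Q$ on $\mathcal A$ for all $n$ and, with $\widehat F_n(t,x)=\widehat F_{n,t}(x)=F_n(t,x)\circ g_n$ and $\widehat G(t,x)=\widehat G_t(x)=G(t,x)\circ g_0$, $(\sup_{t\in E,x\in\mathbb R}|\sqrt n(\widehat F_n(t,x)-F(t,x))-\widehat G(t,x)|)^*\to0$ $\widehat P$-a.s. Such a representation is fixed. Quantiles: $\tau_\alpha(t)=F_t^{-1}(\alpha)=\inf\{x:F(t,x)\ge\alpha\}$ and $\widehat\tau^n_\alpha(t)=\widehat F_{n,t}^{-1}(\alpha)=\inf\{x:\widehat F_n(t,x)\ge\alpha\}$ for $\alpha\in(0,1)$. A closed subinterval of $(0,1)$ means a compact interval $[a,b]\subset(0,1)$. *)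

(* Defs.v *)
From HB Require Import structures.
From mathcomp Require Import all_boot all_order all_algebra.
From mathcomp Require Import all_classical all_reals all_analysis.
From mathcomp Require Import measurable_realfun.

Set Implicit Arguments.
Unset Strict Implicit.
Unset Printing Implicit Defensive.

Import Order.TTheory GRing.Theory Num.Theory.
Import numFieldNormedType.Exports.

Local Open Scope classical_set_scope.
Local Open Scope ring_scope.

(* Supremum of a set of nonnegative quantities, computed in [0, +oo] so that
   the supremum of the empty set is 0. *)
Definition nnsup (R : realType) (A : set (\bar R)) : \bar R :=
  maxe 0%E (ereal_sup A).

Definition sup_norm (R : realType) (S : Type) (z : S -> R) : \bar R :=
  nnsup (range (fun s => (`|z s|)%:E)).

Definition bounded_real (R : realType) (T : Type) (h : T -> R) : Prop :=
  exists M : R, forall x, `|h x| <= M.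

(* l_oo(S) is represented as a (clopen) subset of the space of all real
   functions on S with the topology of uniform convergence; the topology it
   inherits is the one of the sup-norm. *)
Definition linf (R : realType) (S : choiceType) : set {uniform S -> R} :=
  [set z | bounded_real (z : S -> R)].

Definition borel_uniform (R : realType) (S : choiceType) :
    set (set {uniform S -> R}) :=
  <<s [set O : set {uniform S -> R} | open O] >>.

Section nonmeasurable.
Context (d : measure_display) (T : measurableType d) (R : realType).
Variable P : probability T R.

Definition upper_expectation (f : T -> \bar R) : \bar R :=
  ereal_inf [set (\int[P]_w U w)%E | U in
    [set U : T -> \bar R | P.-integrable setT U /\
                           forall w, (f w <= U w)%E]].

Definition is_cover_fun (f g : T -> \bar R) : Prop :=
  [/\ measurable_fun setT g,
      forall w, (f w <= g w)%E &
      forall g' : T -> \bar R, measurable_fun setT g' ->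
        {ae P, forall w, (f w <= g' w)%E} ->
        {ae P, forall w, (g w <= g' w)%E}].

(* A cover always exists and is unique up to a null set; one version is
   selected by choice, so the default value is never used. *)
Definition cover_fun (f : T -> \bar R) : T -> \bar R :=
  xget (cst +oo%E) [set g | is_cover_fun f g].

Definition cvg_in_probability0 (f : nat -> T -> \bar R) : Prop :=
  forall e : R, 0 < e -> P [set w | (e%:E < `|f n w|)%E] @[n --> \oo] --> 0%E.

End nonmeasurable.

Definition perfect_map (R : realType) (d d' : measure_display)
    (T : measurableType d) (T' : measurableType d')
    (P : probability T R) (Q : probability T' R) (g : T -> T') : Prop :=
  forall h : T' -> R, bounded_real h ->
    {ae P, forall w, cover_fun P (fun w => (h (g w))%:E) w =
                     cover_fun Q (fun v => (h v)%:E) (g w)}.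

Section clt.
Context (d : measure_display) (T : measurableType d) (R : realType).
Variable P : probability T R.

(* [normal_prob 0 0] is not the degenerate normal law, so that case is
   given separately. *)
Definition centered_normal (Y : T -> R) : Prop :=
  exists2 s : R, 0 <= s &
    forall A : set R, measurable A ->
      P (Y @^-1` A) = if s == 0 then \d_(0 : R) A else normal_prob 0 s A.

Definition centered_gaussian_process (S : Type) (V : T -> S -> R) : Prop :=
  (forall s, measurable_fun setT (fun w => V w s)) /\
  forall (n : nat) (s : 'I_n -> S) (c : 'I_n -> R),
    centered_normal (fun w => \sum_(i < n) c i * V w (s i)).

Definition radon_law (S : choiceType) (V : T -> {uniform S -> R}) : Prop :=
  [/\ forall w, linf (V w),
      forall B, borel_uniform B -> measurable (V @^-1` B) &
      forall B, borel_uniform B -> forall e : R, 0 < e ->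
        exists K : set {uniform S -> R},
          [/\ compact K, K `<=` B & (P (V @^-1` (B `\` K)) < e%:E)%E]].

(* The test functions [h] are bounded and continuous on l_oo(S), with arbitrary
   (bounded) values elsewhere: the [Vn n] are allowed to be unbounded in [s],
   and the limit may not depend on how [h] is extended outside l_oo(S).  When
   all paths of [Vn n] are bounded only the restriction of [h] to l_oo(S)
   matters. *)
Definition clt_linf (S : choiceType) (Vn : nat -> T -> S -> R)
    (V : T -> S -> R) : Prop :=
  [/\ centered_gaussian_process V,
      radon_law (V : T -> {uniform S -> R}) &
      forall h : {uniform S -> R} -> R,
        bounded_real h -> {within @linf R S, continuous h} ->
        upper_expectation P (fun w => (h (Vn n w))%:E) @[n --> \oo]
          --> ('E_P[fun w => h (V w)])%E].

Definition L2_dist (S : Type) (V : T -> S -> R) (p q : S) : R :=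
  Num.sqrt (fine ('E_P[fun w => ((V w p - V w q) ^+ 2)%R])%E).

Definition L2_unif_continuous_paths (S : Type) (V : T -> S -> R) : Prop :=
  forall w (e : R), 0 < e -> exists2 r : R, 0 < r &
    forall p q, L2_dist V p q < r -> `|V w p - V w q| < e.

End clt.

Section processes.
Context (d : measure_display) (T : measurableType d) (R : realType).
Context (P : probability T R) (E : Type).

Definition sample_path (X : E -> {RV P >-> R}) (w : T) : E -> R := fun t => X t w.

Definition df (X : E -> {RV P >-> R}) (t : E) (x : R) : R := fine (cdf (X t) x).

(* The sample X_1, X_2, ... is numbered from 0. *)
Definition empirical_df (Xs : nat -> E -> {RV P >-> R})
    (n : nat) (w : T) (t : E) (x : R) : R :=
  n%:R^-1 * \sum_(i < n) (Xs i t w <= x)%R%:R.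

End processes.

Definition cylinders (E : Type) (R : realType) : set (set (E -> R)) :=
  <<s [set A | exists (t : E) (B : set R),
         measurable B /\ A = [set z | B (z t)]] >>.

Definition iid_copies (R : realType) (E : Type) (d d' : measure_display)
    (T : measurableType d) (T' : measurableType d')
    (P : probability T R) (Q : probability T' R)
    (X : E -> {RV P >-> R}) (Xs : nat -> E -> {RV Q >-> R}) : Prop :=
  (forall i A, cylinders A ->
     Q (sample_path (Xs i) @^-1` A) = P (sample_path X @^-1` A)) /\
  (forall (n : nat) (A : 'I_n -> set (E -> R)), (forall i, cylinders (A i)) ->
     Q (\bigcap_(i in [set: 'I_n]) (sample_path (Xs i) @^-1` A i)) =
     (\prod_(i < n) Q (sample_path (Xs i) @^-1` A i))%E).

(* The index set of the sets C_{t,x} is identified with E * R.  The last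
   condition selects the version of G with d-uniformly continuous paths. *)
Definition empirical_clt (R : realType) (E : choiceType)
    (d d' : measure_display) (T : measurableType d) (T' : measurableType d')
    (P : probability T R) (Q : probability T' R)
    (X : E -> {RV P >-> R}) (Xs : nat -> E -> {RV Q >-> R})
    (G : E * R -> {RV Q >-> R}) : Prop :=
  [/\ clt_linf Q
        (fun n w (p : E * R) =>
           Num.sqrt n%:R * (empirical_df Xs n w p.1 p.2 - df X p.1 p.2))
        (fun w p => G p w),
      forall s x t y,
        ('E_Q[fun w => (G (s, x) w * G (t, y) w)%R])%E =
        (fine (P [set w | X s w <= x /\ X t w <= y])
           - df X s x * df X t y)%:E &
      L2_unif_continuous_paths Q (fun w p => G p w)].

Definition as_representation (R : realType) (E : choiceType)
    (d d' d'' : measure_display) (T : measurableType d) (T' : measurableType d')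
    (T'' : measurableType d'') (P : probability T R) (Q : probability T' R)
    (Phat : probability T'' R)
    (X : E -> {RV P >-> R}) (Xs : nat -> E -> {RV Q >-> R})
    (G : E * R -> {RV Q >-> R}) (g : nat -> T'' -> T') : Prop :=
  [/\ forall n, measurable_fun setT (g n),
      forall n, perfect_map Phat Q (g n),
      forall n A, measurable A -> Phat (g n @^-1` A) = Q A &
      {ae Phat, forall w,
         cover_fun Phat
           (fun w => sup_norm (fun p : E * R =>
              Num.sqrt n%:R * (empirical_df Xs n (g n w) p.1 p.2 - df X p.1 p.2)
              - G p (g 0%N w))) w @[n --> \oo] --> 0%E}].

Definition is_density (R : realType) (F f : R -> R) : Prop :=
  [/\ measurable_fun setT f,
      forall u, 0 <= f u &
      forall x, (F x)%:E =
        (\int[lebesgue_measure]_(u in `]-oo, x]) (f u)%:E)%E].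

Definition quantile (R : realType) (F : R -> R) (a : R) : R :=
  inf [set x | a <= F x].

(* Main.v *)
Require Import Defs.
From HB Require Import structures.
From mathcomp Require Import all_boot all_order all_algebra.
From mathcomp Require Import all_classical all_reals all_analysis.
From mathcomp Require Import measurable_realfun.
From mathcomp Require Import ring lra.

(** The almost sure representation reduces the theorem to a statement about
single paths.  Off an event of small probability the path [z] of
[x |-> Ghat t x] is bounded, and uniformly continuous for the L2-distance, with
constants that do not depend on [t] or on the sample point, because a Radon law
charges mostly a compact set of paths ([radon_uniform_paths]); and [sqrt n * (Fhat n - F)] is
uniformly close to [z] there ([outer_cvg0_ae]).  On that event nothing random is
left.  If [x] is the empirical quantile and [tau] the true one at level [a],
then [Fhat n] is at least [a] at [x] and less than [a] on the left of [x], so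
that [sqrt n * (F x - a) + z x] is close to 0.  Hence [F x - a] has the order of
[1 / sqrt n].  The lower bound on the density makes [x] close to [tau]; the
L2-distance between the indices of [z x] and [z tau] is at most the square root
of [F x - F tau] in absolute value ([L2_dist_df]), which allows replacing [z x]
by [z tau]; and the equicontinuity of the densities allows replacing
[F x - F tau] by [f tau * (x - tau)].  This is [quantile_inversion].

The weak convergences follow from a Slutsky argument ([slutsky]), but with the
limit [- Ghat], and it remains to know that a centered Gaussian process with a
Radon law has the law of its opposite ([gaussian_reflect]).  Its one-dimensional
projections are symmetric, so the expectation of a trigonometric polynomial in
finitely many coordinates is not changed by reflection; these polynomials are
dense on every compact set, by the Stone-Weierstrass argument of
[stone_weierstrass], and the law is tight.

Nonmeasurable suprema are dominated on measurable events, in the form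
[outer_cvg0]; the passage between this form and cover functions needs the
existence of measurable covers ([cover_fun_exists]). *)

Set Implicit Arguments.
Unset Strict Implicit.
Unset Printing Implicit Defensive.

Import Order.TTheory GRing.Theory Num.Theory.
Import numFieldNormedType.Exports.

Local Open Scope classical_set_scope.
Local Open Scope ring_scope.

(** * Measurable covers *)

Section cover.
Context (d : measure_display) (T : measurableType d) (R : realType).
Variable P : probability T R.

Lemma bounded_integrable (h : T -> R) (M : R) :
  measurable_fun setT h -> (forall x, `|h x| <= M) ->
  P.-integrable setT (EFin \o h).
Proof.
move=> mh hM; apply: measurable_bounded_integrable => //.
  exact: fin_num_fun_lty.
exists M; split; first by rewrite num_real.
by move=> x xM t _ /=; rewrite (le_trans (hM t))// ltW.
Qed.

Lemma measurable_contract (g : T -> \bar R) :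
  measurable_fun setT g -> measurable_fun setT (fun x => contract (g x)).
Proof.
move=> mg mT; apply: (measurability _ (RGenOInfty.measurableE R)) => //.
move=> _ [_ [r ->] <-]; rewrite preimage_itvoy.
have [r1|r1] := leP `|r| 1.
  rewrite (_ : [set _ | _] = [set x | (expand r < g x)%E]).
    exact: emeasurable_fun_o_infty.
  by apply/seteqP; split=> x /=; rewrite lt_expandLR// inE.
have [r0|r0] := leP 0 r.
  rewrite (_ : [set _ | _] = set0) ?setI0//.
  apply/seteqP; split=> x //= h; have := contract_le1 (g x).
  move: r1; rewrite ger0_norm// => r1 /ler_normlW gx.
  by move: (lt_trans r1 h); rewrite ltNge gx.
rewrite (_ : [set _ | _] = setT) ?setIT//.
apply/seteqP; split=> x //= _; have := contract_le1 (g x).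
rewrite ler_norml => /andP[+ _]; apply: lt_le_trans.
by move: r1; rewrite ltr0_norm// ltrNr.
Qed.

(** A measurable majorant of least integral is, up to null sets, the least
measurable majorant. Composing with the increasing bounded map [contract]
makes all the integrals finite, and the least value is attained because
countable infima of majorants are majorants. *)
Lemma cover_fun_exists (f : T -> \bar R) : exists g, is_cover_fun P f g.
Proof.
pose maj := [set g : T -> \bar R | measurable_fun setT g /\
                                   forall w, (f w <= g w)%E].
pose phi (g : T -> \bar R) := (fun x => contract (g x)).
pose J g := fine (\int[P]_x (phi g x)%:E)%E.
have phi1 g x : `|phi g x| <= 1 by exact: contract_le1.
have iphi g : maj g -> P.-integrable setT (EFin \o phi g).
  move=> [mg _]; apply: (@bounded_integrable _ 1) => //.
  exact: measurable_contract.
have JE g : maj g -> (\int[P]_x (phi g x)%:E)%E = (J g)%:E.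
  by move=> /iphi/integrable_fin_num => /(_ measurableT) h; rewrite /J fineK.
have J_le g g' : maj g -> maj g' -> (forall x, (g x <= g' x)%E) -> J g <= J g'.
  move=> mg mg' gg'; rewrite -lee_fin -!JE//; apply: le_integral => //.
  - exact: iphi.
  - exact: iphi.
  by move=> x _; rewrite lee_fin le_contract.
have majy : maj (cst +oo%E) by split => // w; rewrite leey.
have J1 g : maj g -> - 1 <= J g.
  move=> mg; rewrite -lee_fin -JE//.
  have -> : ((- 1)%:E = \int[P]_x (cst (- 1)%:E x))%E.
    by rewrite integral_cst//= probability_setT mule1.
  apply: le_integral => //; [|exact: iphi|].
    exact: finite_measure_integrable_cst.
  by move=> x _; rewrite lee_fin; have := phi1 g x; rewrite ler_norml => /andP[].
pose A := [set J g | g in maj].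
have hA : has_inf A.
  split; first by exists (J (cst +oo%E)), (cst +oo%E).
  by exists (-1) => _ [g mg <-]; exact: J1.
have /choice[g_ gP] : forall k : nat, exists g, maj g /\ J g < inf A + k.+1%:R^-1.
  move=> k; have [|_ [g mg <-] h] := @inf_adherent _ A (k.+1%:R^-1) _ hA.
    by rewrite invr_gt0.
  by exists g.
pose g x := einfs (g_ ^~ x) 0%N.
have gE x : g x = ereal_inf (range (g_ ^~ x)).
  rewrite /g /einfs /sdrop; congr ereal_inf.
  by apply/seteqP; split => y [k _ <-]; exists k.
have g_le k x : (g x <= g_ k x)%E.
  by rewrite gE; apply: ereal_inf_lbound; exists k.
have mg : maj g.
  split; first by apply: measurable_fun_einfs => k; case: (gP k) => -[].
  move=> w; rewrite gE; apply: le_ereal_inf_tmp => _ [k _ <-].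
  by case: (gP k) => -[].
have Jg : J g = inf A.
  apply/eqP; rewrite eq_le; apply/andP; split; last first.
    by apply: ge_inf; [case: hA|exists g].
  apply/ler_addgt0Pr => e e0.
  have [k ke] : exists k : nat, k.+1%:R^-1 < e.
    have [k _ h] := near_infty_natSinv_lt (PosNum e0).
    by exists k; exact: h k (leqnn _).
  have [mk Jk] := gP k.
  rewrite (le_trans (J_le _ _ mg mk (g_le k)))// (le_trans (ltW Jk))// lerD2l.
  exact: ltW.
exists g; split; [exact: mg.1|exact: mg.2|].
move=> g' mg' [N [mN PN0 fN]].
(* A majorant almost everywhere becomes a majorant when it is set to +oo on the
   exceptional null set. *)
pose h x := if x \in N then +oo%E else g' x.
have mh : maj h.
  split.
    apply: measurable_fun_ifT => //.
    by apply: (measurable_fun_bool true); rewrite setTI preimage_mem_true.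
  move=> w; rewrite /h; case: ifPn; first by rewrite leey.
  move=> /negP wN; apply: contrapT => nle; apply: wN; rewrite inE.
  exact: fN.
pose k x := mine (g x) (h x).
have mk : maj k.
  split; first by apply: measurable_mine; [exact: mg.1|exact: mh.1].
  by move=> w; rewrite /k le_min (mg.2 w) (mh.2 w).
have kg x : (k x <= g x)%E by rewrite /k ge_min lexx.
have Jk : J k = J g.
  apply/eqP; rewrite eq_le J_le//= Jg.
  by apply: ge_inf; [case: hA|exists k].
have : ae_eq P setT (fun x => (phi g x)%:E - (phi k x)%:E)%E (cst 0%E).
  apply/ae_eq_integral_abs => //.
    apply: emeasurable_funB; apply/measurable_EFinP; apply: measurable_contract.
      exact: mg.1.
    exact: mk.1.
  rewrite (eq_integral (fun x => (phi g x)%:E - (phi k x)%:E)%E); last first.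
    move=> x _; rewrite gee0_abs// -EFinB lee_fin subr_ge0.
    by rewrite le_contract.
  rewrite integralB//; [|exact: iphi|exact: iphi].
  by rewrite [X in (X - _)%E]JE// [X in (_ - X)%E]JE// Jk -EFinB subrr.
case=> M [mM PM0 fM]; exists (M `|` N); split.
- exact: measurableU.
- by apply: null_set_setU.
move=> x /= nle.
have [xN|xN] := boolP (x \in N); [by right; move: xN; rewrite inE|left].
apply: fM => /= eq0; apply: nle; have := eq0 I.
rewrite -EFinB => -[] /eqP; rewrite subr_eq0 => /eqP/contract_inj gk.
by rewrite gk /k /h (negbTE xN) ge_min lexx orbT.
Qed.

End cover.

(** * The topology of uniform convergence *)

Section uniform_functions.
Context {R : realType} {S : choiceType}.
Implicit Types (z y : {uniform S -> R}) (A : set {uniform S -> R}).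

Lemma nbhs_uniformP z A : nbhs z A <->
  exists2 e : R, 0 < e & forall y : S -> R, (forall s, `|y s - z s| <= e) -> A y.
Proof.
split=> [/uniform_nbhs[B [entB BA]]|[e e0 eA]].
  move: entB => /=; rewrite -entourage_ballE => -[/= e e0 eB].
  exists (e / 2); first by rewrite divr_gt0.
  move=> y yz; apply: BA => s _; apply: eB => /=.
  by rewrite /ball/= distrC (le_lt_trans (yz s))// ltr_pdivrMr// ltr_pMr// ltr1n.
apply: (uniform_nbhs z A).2; exists [set p | `|p.1 - p.2| < e]; split.
  by rewrite -entourage_ballE; exists e.
by move=> y /= yz; apply: eA => s; rewrite distrC ltW// yz.
Qed.

Lemma near_uniform z (e : R) : 0 < e ->
  \forall y \near z, forall s, `|(y : S -> R) s - z s| <= e.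
Proof. by move=> e0; apply/nbhs_uniformP; exists e. Qed.

Lemma bounded_real_close (z y : S -> R) (e : R) :
  (forall s, `|y s - z s| <= e) -> bounded_real z -> bounded_real y.
Proof.
move=> yz [M zM]; exists (e + M) => s.
by rewrite -(subrK (z s) (y s)) (le_trans (ler_normD _ _))// lerD.
Qed.

Lemma linf_open : open (@linf R S).
Proof.
rewrite openE => z zb; apply/nbhs_uniformP; exists 1 => // y yz.
exact: bounded_real_close yz zb.
Qed.

Lemma uniform_hausdorff : hausdorff_space {uniform S -> R}.
Proof.
move=> z y zy; apply/funext => s; apply/eqP; rewrite -subr_eq0 -normr_le0.
apply/ler_addgt0Pr => e e0; rewrite add0r.
have e20 : 0 < e / 2 by rewrite divr_gt0.
have [x [xz xy]] := zy _ _ (near_uniform z e20) (near_uniform y e20).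
rewrite -(subrK (x s) (z s)) -addrA (le_trans (ler_normD _ _))// [leRHS]splitr.
by rewrite lerD// distrC.
Qed.

Lemma compact_borel A : compact A -> borel_uniform (~` A).
Proof.
move=> cA; apply: sub_sigma_algebra; rewrite /= openC.
by apply: compact_closed cA; exact: uniform_hausdorff.
Qed.

Lemma continuous_uniformP (u : {uniform S -> R} -> R) z :
  {for z, continuous u} <->
  forall e : R, 0 < e -> exists2 r : R, 0 < r &
    forall y : S -> R, (forall s, `|y s - z s| <= r) -> `|u y - u z| <= e.
Proof.
have cP := @cvgrPdist_le R R^o _ (nbhs z) (nbhs_filter z) u (u z).
split=> [/cP cu e /cu/nbhs_uniformP[r r0 H]|H].
  by exists r => // y /H; rewrite distrC.
apply/cP => e /H[r r0 ur]; apply/nbhs_uniformP; exists r => // y /ur.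
by rewrite distrC.
Qed.

(** The bounded functions form a clopen set, since boundedness is preserved by
a perturbation of finite sup-norm; so cutting a function off outside them keeps
it continuous. *)
Lemma continuous_linf_patch (h : {uniform S -> R} -> R) :
  {within @linf R S, continuous h} -> continuous (h \_ (@linf R S)).
Proof.
rewrite continuous_open_subspace; last exact: linf_open.
move=> ch z; apply/continuous_uniformP => e e0.
have [zl|zl] := pselect (linf z).
  have /continuous_uniformP/(_ e e0)[r r0 hr] := ch z (mem_set zl).
  exists r => // y yz; have yl : linf y by exact: bounded_real_close yz zl.
  by rewrite !patchE (mem_set zl) (mem_set yl); exact: hr.
exists 1 => // y yz; rewrite !patchE !memNset ?subrr ?normr0 ?ltW//.
move=> yl; apply: zl; apply: (bounded_real_close (e := 1) _ yl) => s.
by rewrite distrC; exact: yz.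
Qed.

(** A condition which holds locally for all small values of its parameter
holds on a compact set for one common value: this is the covering property of
compact sets, with the parameter running along the filter of small positive
reals. *)
Lemma compact_uniform_small (K : set {uniform S -> R})
    (Phi : R -> {uniform S -> R} -> Prop) :
  compact K ->
  (forall z, K z -> exists2 r : R, 0 < r & exists2 e : R, 0 < e &
    forall (y : S -> R) (r' : R),
      (forall s, `|y s - z s| <= e) -> 0 < r' -> r' <= r -> Phi r' y) ->
  exists2 r : R, 0 < r & forall z, K z -> Phi r z.
Proof.
move=> /compact_near_coveringP Kc loc.
have [|r /= r0 H] := Kc R (0^'+) (fun r z => Phi r z) _.
  move=> z /loc[r r0 [e e0 H]].
  exists ([set y : {uniform S -> R} | forall s, `|y s - z s| <= e], `]0, r]%classic).
    split; first exact: near_uniform.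
    apply: filterS2 (nbhs_right_gt 0) (nbhs_right_le r0) => r' r'0 r'r /=.
    by rewrite in_itv/= r'0.
  move=> [y r'] [/= yz]; rewrite in_itv/= => /andP[r'0 r'r].
  exact: H.
have r20 : 0 < r / 2 by rewrite divr_gt0.
exists (r / 2) => // z Kz; apply: (H (r / 2)) => //=.
by rewrite sub0r normrN gtr0_norm// ltr_pdivrMr// ltr_pMr// ltr1n.
Qed.

End uniform_functions.

(** * Convergence in outer probability *)

Section outer_convergence.
Context (d : measure_display) (T : measurableType d) (R : realType).
Variable P : probability T R.

Lemma cover_funP (f : T -> \bar R) : is_cover_fun P f (cover_fun P f).
Proof. by have [g gf] := cover_fun_exists P f; exact: (xgetI _ gf). Qed.

(** Convergence to 0 in outer probability of the sup-norms of [Z n], stated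
with measurable events so that no sup-norm has to be measured. *)
Definition outer_cvg0 (S : Type) (Z : nat -> T -> S -> R) : Prop :=
  forall e r : R, 0 < e -> 0 < r -> \forall n \near \oo,
    exists A : set T, [/\ measurable A, (P (~` A) < e%:E)%E &
      forall w s, A w -> `|Z n w s| <= r].

Lemma outer_cvg0_scale (S S' : Type) (c : S' -> R) (C : R) (phi : S' -> S)
    (Z : nat -> T -> S -> R) : (forall s, `|c s| <= C) ->
  outer_cvg0 Z -> outer_cvg0 (fun n w s => c s * Z n w (phi s)).
Proof.
move=> cC Z0 e r e0 r0.
have C0 : 0 < `|C| + 1 by rewrite ltr_wpDl.
apply: filterS (Z0 e (r / (`|C| + 1)) e0 (divr_gt0 r0 C0)) => n [A [mA PA ZA]].
exists A; split => // w s Aw; rewrite normrM -(divfK (lt0r_neq0 C0) r) mulrC.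
apply: ler_pM => //; first exact: ZA.
by rewrite (le_trans (cC s))// (le_trans (ler_norm C))// lerDl.
Qed.

Lemma sup_norm_le (S : Type) (z : S -> R) (r : R) :
  0 <= r -> (sup_norm z <= r%:E)%E <-> forall s, `|z s| <= r.
Proof.
move=> r0; rewrite /sup_norm /nnsup ge_max lee_fin r0/=; split=> [zr s|zr].
  by rewrite -lee_fin; apply: le_trans zr; apply: ereal_sup_ubound; exists s.
by apply: ge_ereal_sup => _ [s _ <-]; rewrite lee_fin.
Qed.

(** The function equal to [r] on the good event and to [+oo] off it is a
measurable majorant of the sup-norm, hence of its cover. *)
Lemma outer_cvg0_cover (S : Type) (Z : nat -> T -> S -> R) :
  outer_cvg0 Z ->
  cvg_in_probability0 P (fun n => cover_fun P (fun w => sup_norm (Z n w))).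
Proof.
move=> Z0 r r0.
pose c n := cover_fun P (fun w => sup_norm (Z n w)).
have mc n : measurable_fun setT (c n).
  by case: (cover_funP (fun w => sup_norm (Z n w))).
have cge n w : (sup_norm (Z n w) <= c n w)%E.
  by case: (cover_funP (fun w => sup_norm (Z n w))).
pose B n := [set w | (r%:E < `|c n w|)%E].
have mB n : measurable (B n).
  rewrite -[B n]setTI; apply: emeasurable_fun_o_infty => //.
  by apply: measurableT_comp.
apply/fine_cvgP; split; first by apply: nearW => n; apply: fin_num_measure; exact: mB.
apply/cvgrPdist_le => e e0; apply: filterS (Z0 e r e0 r0) => n [A [mA PA ZA]].
have : (P (B n) <= P (~` A))%E.
  pose c' w := if w \in A then r%:E else +oo%E : \bar R.
  have [_ _ /(_ c')[||N [mN PN0 cN]]] := cover_funP (fun w => sup_norm (Z n w)).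
  - apply: measurable_fun_ifT => //.
    by apply: (measurable_fun_bool true); rewrite setTI preimage_mem_true.
  - apply: aeW => w; rewrite /c'; case: ifPn => [|_]; last by rewrite leey.
    by rewrite inE => Aw; apply/sup_norm_le; [exact: ltW|move=> s; exact: ZA].
  have BAN : B n `<=` ~` A `|` N.
    move=> w Bw; have [Aw|] := pselect (A w); [right|by left].
    have cw0 : (0 <= c n w)%E.
      by apply: le_trans (cge n w); rewrite /sup_norm /nnsup le_max lexx.
    apply: cN => /=; rewrite /c' mem_set// => cr; move: Bw.
    by rewrite /B/= gee0_abs// => /lt_le_trans/(_ cr); rewrite ltxx.
  have <- : P (~` A `|` N) = P (~` A).
    by apply: measureU0 => //; exact: measurableC.
  apply: le_measure => //; rewrite inE//.
  by apply: measurableU => //; exact: measurableC.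
move=> /le_lt_trans/(_ PA); rewrite sub0r normrN ger0_norm ?fine_ge0// => Pe.
by rewrite -lee_fin fineK ?ltW//; apply: fin_num_measure; exact: mB.
Qed.

(** Almost sure convergence implies convergence in probability, by continuity
of [P] along the tail events; these are measurable because the covers are, and
the covers dominate the sup-norms at every point. *)
Lemma outer_cvg0_ae (S : Type) (Z : nat -> T -> S -> R) :
  {ae P, forall w, cover_fun P (fun w => sup_norm (Z n w)) w @[n --> \oo] --> 0%E} ->
  outer_cvg0 Z.
Proof.
move=> [N [mN PN0 cN]] e r e0 r0.
pose c n := cover_fun P (fun w => sup_norm (Z n w)).
have mc n : measurable_fun setT (c n).
  by case: (cover_funP (fun w => sup_norm (Z n w))).
have cge n w : (sup_norm (Z n w) <= c n w)%E.
  by case: (cover_funP (fun w => sup_norm (Z n w))).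
pose B n := [set w | (r%:E < c n w)%E].
have mB n : measurable (B n).
  by rewrite -[B n]setTI; exact: emeasurable_fun_o_infty.
pose C n := \bigcup_(k >= n) B k.
have mC n : measurable (C n) by apply: bigcup_measurable => k _.
have CN : \bigcap_n C n `<=` N.
  move=> w Cw; apply: cN => /= /fine_cvgP[fc /cvgrPdist_lt/(_ _ r0)].
  move=> /(filterI fc)[n _ /= nc]; have [k /= nk] := Cw n I.
  have [fk] := nc k nk; rewrite sub0r normrN => ck.
  rewrite /B/= /c -(fineK fk) lte_fin => rk.
  by move: (lt_trans rk (le_lt_trans (ler_norm _) ck)); rewrite ltxx.
have : P (C n) @[n --> \oo] --> P (\bigcap_n C n).
  apply: nonincreasing_cvg_mu => //; first by rewrite ltey_eq fin_num_measure.
    by apply: bigcapT_measurable => n; exact: mC.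
  move=> m n mn; apply/subsetPset => w [k /= nk Bk].
  by exists k => //=; exact: leq_trans nk.
rewrite (_ : P (\bigcap_n C n) = 0%E); last first.
  by apply/eqP; rewrite -measure_le0 -PN0 le_measure ?inE//; apply: bigcapT_measurable.
move=> /fine_cvgP[_ /cvgrPdist_lt/(_ _ e0)]; apply: filterS => n /=.
rewrite sub0r normrN => Ce; exists (~` C n); split; first exact: measurableC.
  rewrite setCK -[X in (X < _)%E]fineK ?lte_fin ?fin_num_measure//.
  exact: le_lt_trans (ler_norm _) Ce.
move=> w s Cw; apply: (sup_norm_le _ (ltW r0)).1.
apply: (le_trans (cge n w)); rewrite leNgt; apply/negP => Bw.
by apply: Cw; exists n => /=.
Qed.

End outer_convergence.

(** * Upper expectations and Radon laws *)

Section weak_convergence.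
Context (d : measure_display) (T : measurableType d) (R : realType).
Variable P : probability T R.

Lemma integral_affine_indic (k : T -> R) (M a b : R) (N : set T) :
  measurable_fun setT k -> (forall w, `|k w| <= M) -> measurable N ->
  P.-integrable setT (EFin \o (fun w => k w + (a + b * \1_N w))) /\
  (\int[P]_w (k w + (a + b * \1_N w))%:E =
   (fine (\int[P]_w (k w)%:E) + (a + b * fine (P N)))%:E)%E.
Proof.
move=> mk kM mN.
have ik := bounded_integrable P mk kM.
have i1 : P.-integrable setT (EFin \o (\1_N : T -> R)).
  apply: (@bounded_integrable _ _ _ _ _ 1) => // w.
  by rewrite indicE; case: (_ \in _); rewrite ?normr1 ?normr0 ?ler01.
have ia : P.-integrable setT (EFin \o (cst a : T -> R)).
  exact: finite_measure_integrable_cst.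
have ib : P.-integrable setT (fun w => b%:E * (EFin \o (\1_N : T -> R)) w)%E.
  exact: integrableZl.
have iab : P.-integrable setT (EFin \o (cst a : T -> R) \+
    (fun w => b%:E * (EFin \o (\1_N : T -> R)) w))%E by exact: integrableD.
have E : EFin \o (fun w => k w + (a + b * \1_N w)) =
    ((EFin \o k) \+ (EFin \o (cst a : T -> R) \+
      (fun w => b%:E * (EFin \o (\1_N : T -> R)) w)))%E.
  by apply/funext => w /=; rewrite -EFinM -!EFinD.
have -> : (\int[P]_w (k w + (a + b * \1_N w))%:E =
    \int[P]_w (EFin \o (fun w => k w + (a + b * \1_N w))%R) w)%E by [].
rewrite E; split; first exact: integrableD.
rewrite integralD//= integralD//= integral_cst//= integralZl//= integral_indic// setIT.
rewrite probability_setT mule1 !EFinD EFinM !fineK//; first exact: fin_num_measure.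
exact: (integrable_fin_num measurableT ik).
Qed.

(** If the measurable [k] is within [e] of [f] off [N], then [f] lies between the
measurable functions [k - e - 2 * M * \1_N] and [k + e + 2 * M * \1_N]. *)
Lemma upper_expectation_close (f k : T -> R) (M e : R) (N : set T) :
  measurable_fun setT k -> (forall w, `|k w| <= M) -> (forall w, `|f w| <= M) ->
  measurable N -> 0 <= e -> (forall w, ~ N w -> `|f w - k w| <= e) ->
  upper_expectation P (EFin \o f) \is a fin_num /\
  `|fine (upper_expectation P (EFin \o f)) - fine (\int[P]_w (k w)%:E)%E|
    <= e + 2 * M * fine (P N).
Proof.
move=> mk kM fM mN e0 fk.
have fkN w : `|f w - k w| <= e + 2 * M * \1_N w.
  have [Nw|Nw] := pselect (N w).
    rewrite indicE mem_set// mulr1 (le_trans (ler_normB _ _))//.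
    by rewrite mulrDl mul1r (le_trans (lerD (fM w) (kM w)))// lerDr.
  by rewrite indicE memNset// mulr0 addr0 fk.
have [iU IU] := integral_affine_indic e (2 * M) mk kM mN.
have [iL IL] := integral_affine_indic (- e) (- (2 * M)) mk kM mN.
set c := fine (\int[P]_w (k w)%:E)%E in IU IL *.
have upper_le : (upper_expectation P (EFin \o f) <= (c + (e + 2 * M * fine (P N)))%:E)%E.
  rewrite -IU; apply: ereal_inf_lbound; eexists; last reflexivity.
  split => // w; rewrite lee_fin -lerBlDl.
  exact: le_trans (ler_norm _) (fkN w).
have upper_ge : ((c + (- e + - (2 * M) * fine (P N)))%:E <= upper_expectation P (EFin \o f))%E.
  rewrite -IL; apply: le_ereal_inf_tmp => _ [U [iU' fU] <-].
  apply: le_integral => // w _; apply: le_trans (fU w).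
  rewrite lee_fin -lerBrDl mulNr -opprD lerNl opprB.
  by apply: le_trans (fkN w); rewrite distrC ler_norm.
have fin : upper_expectation P (EFin \o f) \is a fin_num.
  by rewrite fin_numElt (lt_le_trans _ upper_ge) ?ltNyr// (le_lt_trans upper_le) ?ltry.
split=> //; move: upper_le upper_ge; rewrite -(fineK fin) !lee_fin => ule uge.
rewrite ler_norml lerBlDl ule andbT lerBrDl.
by move: uge; rewrite mulNr -opprD.
Qed.

End weak_convergence.

Section radon_laws.
Context (d : measure_display) (T : measurableType d) (R : realType).
Variable P : probability T R.

Lemma continuous_borel (S S' : choiceType)
    (r : {uniform S' -> R} -> {uniform S -> R}) (B : set {uniform S -> R}) :
  continuous r -> borel_uniform B -> borel_uniform (r @^-1` B).
Proof.
move=> /continuousP cr; apply: (smallest_sub (X := [set B | borel_uniform (r @^-1` B)])).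
  split=> /=.
  - by rewrite preimage_set0; exact: sigma_algebra0.
  - move=> A /= rA; rewrite setTD preimage_setC -setTD.
    exact: (sigma_algebraCD rA).
  - move=> F /= rF; rewrite preimage_bigcup.
    exact: sigma_algebra_bigcup.
by move=> O oO /=; apply: sub_sigma_algebra; exact: cr.
Qed.

(** Reindexing by [phi] and rescaling by the bounded [c] is a continuous map, so
it pulls Borel sets back to Borel sets and maps the compact sets that carry most
of the law of [V] to compact sets. *)
Lemma radon_law_image (d' : measure_display) (T' : measurableType d')
    (Q : probability T' R) (S S' : choiceType) (V : T' -> {uniform S' -> R})
    (g : T -> T') (phi : S -> S') (c : S -> R) (C : R) :
  measurable_fun setT g -> (forall A, measurable A -> P (g @^-1` A) = Q A) ->
  (forall s, `|c s| <= C) -> radon_law Q V ->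
  radon_law P (fun w => (fun s => c s * V (g w) (phi s)) : {uniform S -> R}).
Proof.
move=> mg Pg cC [Vlinf Vm Vtight].
pose r (z : {uniform S' -> R}) : {uniform S -> R} := fun s => c s * z (phi s).
have cr : continuous r.
  move=> z A /nbhs_uniformP[e e0 eA].
  have C0 : 0 < `|C| + 1 by rewrite ltr_wpDl.
  apply/nbhs_uniformP; exists (e / (`|C| + 1)); first exact: divr_gt0.
  move=> y yz; apply: eA => s; rewrite /r -mulrBr normrM.
  rewrite -(divfK (lt0r_neq0 C0) e) mulrC; apply: ler_pM => //.
  by rewrite (le_trans (cC s))// (le_trans (ler_norm C))// lerDl.
have mgV A : measurable A -> measurable (g @^-1` A).
  by move=> mA; rewrite -[_ @^-1` _]setTI; exact: mg.
have mrV B : borel_uniform B -> measurable ((r \o V \o g) @^-1` B).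
  by move=> bB; exact: mgV _ (Vm _ (continuous_borel cr bB)).
split => //.
  move=> w; have [M VM] := Vlinf (g w); exists (C * M) => s.
  by rewrite normrM; apply: ler_pM.
move=> B bB e e0; have [K [cK KB PK]] := Vtight _ (continuous_borel cr bB) e e0.
exists (r @` K); split.
- by apply: continuous_compact => //; exact: continuous_subspaceT.
- by move=> _ [z Kz <-]; exact: KB.
have mK : measurable (V @^-1` (r @^-1` B `\` K)).
  rewrite setDE preimage_setI; apply: measurableI.
    by apply: Vm; exact: continuous_borel.
  by apply: Vm; exact: compact_borel.
apply: le_lt_trans PK; rewrite -Pg//; apply: le_measure; rewrite ?inE.
- rewrite setDE preimage_setI; apply: measurableI; first exact: mrV.
  by apply: mrV; apply: compact_borel; apply: continuous_compact => //; exact: continuous_subspaceT.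
- exact: mgV.
by move=> w [Bw nKw]; split => // Kw; apply: nKw; exists (V (g w)).
Qed.

End radon_laws.

Section slutsky.
Context (d : measure_display) (T : measurableType d) (R : realType).
Variable P : probability T R.
Variable S : choiceType.

Lemma measurable_continuous_comp (V : T -> {uniform S -> R})
    (u : {uniform S -> R} -> R) :
  (forall B, borel_uniform B -> measurable (V @^-1` B)) -> continuous u ->
  measurable_fun setT (fun w => u (V w)).
Proof.
move=> mV /continuousP cu _; apply: (measurability _ (RGenOInfty.measurableE R)) => //.
move=> _ [_ [r ->] <-]; rewrite setTI.
apply: (mV (u @^-1` `]r, +oo[%classic)); apply: sub_sigma_algebra; apply: cu.
exact: interval_open.
Qed.

Lemma expectation_integral (X : T -> R) : 'E_P[X]%E = (\int[P]_w (X w)%:E)%E.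
Proof. by rewrite unlock. Qed.

(** On a compact set that carries most of the law of [V], the test function is
uniformly continuous, even with respect to perturbations leaving that set; so
[h (Vn n)] is close to [h V] off an event of small probability. *)
Lemma slutsky (V : T -> {uniform S -> R}) (Vn : nat -> T -> S -> R)
    (h : {uniform S -> R} -> R) :
  radon_law P V -> outer_cvg0 P (fun n w s => Vn n w s - V w s) ->
  bounded_real h -> {within @linf R S, continuous h} ->
  upper_expectation P (fun w => (h (Vn n w))%:E) @[n --> \oo]
    --> ('E_P[fun w => h (V w)])%E.
Proof.
move=> [Vl Vm Vt] VnV [M hM] /continuous_linf_patch ch.
have hE z : linf z -> (h \_ (@linf R S)) z = h z by move=> zl; rewrite patchE mem_set.
set h0 := h \_ (@linf R S) in ch hE.
have mh : measurable_fun setT (fun w => h (V w)).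
  apply: (eq_measurable_fun (fun w => h0 (V w))); first by move=> w _; exact/hE/Vl.
  exact: measurable_continuous_comp.
have M0 : 0 <= M by apply: le_trans (hM (fun=> 0)).
have fin : (\int[P]_w (h (V w))%:E)%E \is a fin_num.
  apply: (integrable_fin_num measurableT).
  by apply: (@bounded_integrable _ _ _ P (fun w => h (V w)) M).
rewrite expectation_integral -(fineK fin); apply/fine_cvgP.
suff main : forall e : R, 0 < e -> \forall n \near \oo,
    upper_expectation P (fun w => (h (Vn n w))%:E) \is a fin_num /\
    `|fine (upper_expectation P (fun w => (h (Vn n w))%:E)) -
      fine (\int[P]_w (h (V w))%:E)%E| <= e + 2 * M * (2 * e).
  split; first by apply: filterS (main 1 ltr01) => n [].
  apply/cvgrPdist_le => e e0.
  have M1 : 0 < 1 + 4 * M by rewrite ltr_pwDl// mulr_ge0.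
  apply: filterS (main (e / (1 + 4 * M)) (divr_gt0 e0 M1)) => n [_].
  rewrite distrC => /le_trans; apply.
  rewrite -[leRHS](divfK (lt0r_neq0 M1)); set x := e / _.
  by rewrite le_eqVlt; apply/orP; left; apply/eqP; ring.
move=> e e0.
have borel_linf : borel_uniform (@linf R S).
  by apply: sub_sigma_algebra; exact: linf_open.
have [K [cK Kl PK]] := Vt _ borel_linf e e0.
have [r r0 hK] : exists2 r : R, 0 < r & forall z, K z -> forall y : S -> R,
    (forall s, `|y s - z s| <= r) -> `|h y - h z| <= e.
  apply: (compact_uniform_small (Phi := fun r z => forall y : S -> R,
    (forall s, `|y s - z s| <= r) -> `|h y - h z| <= e) cK) => z /Kl zl.
  have /continuous_uniformP/(_ (e / 2))[|r r0 hr] := ch z; first by rewrite divr_gt0.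
  have r2 : 0 < r / 2 by rewrite divr_gt0.
  exists (r / 2) => //; exists (r / 2) => // y r' yz r'0 r'r x xy.
  have yl := bounded_real_close yz zl.
  rewrite -!hE//; last exact: bounded_real_close xy yl.
  rewrite -(subrK (h0 z) (h0 x)) -addrA (le_trans (ler_normD _ _))// [leRHS]splitr.
  apply: lerD; last first.
    rewrite distrC; apply: hr => s; rewrite (le_trans (yz s))//.
    by rewrite ler_pdivrMr// ler_peMr ?ltW// ltr1n.
  apply: hr => s; rewrite -(subrK (y s) (x s)) -addrA (le_trans (ler_normD _ _))// [leRHS]splitr.
  by rewrite lerD// (le_trans (xy s)).
apply: filterS (VnV e r e0 r0) => n [A [mA PA AV]].
have mK : measurable (V @^-1` (@linf R S `\` K)).
  rewrite setDE preimage_setI; apply: measurableI; first exact: Vm.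
  by apply: Vm; exact: compact_borel.
have mN : measurable (~` A `|` V @^-1` (@linf R S `\` K)).
  by apply: measurableU => //; exact: measurableC.
have PN : fine (P (~` A `|` V @^-1` (@linf R S `\` K))) <= 2 * e.
  rewrite -lee_fin fineK ?fin_num_measure//.
  apply: le_trans (measureU2 _ _ _) _ => //; first exact: measurableC.
  by rewrite mulrDl mul1r EFinD leeD// ltW.
have [|] := @upper_expectation_close _ _ _ P (fun w => h (Vn n w)) (fun w => h (V w))
  M e _ mh (fun w => hM _) (fun w => hM _) mN (ltW e0).
  move=> w /not_orP[/contrapT Aw nKw]; apply: hK; last by move=> s; exact: AV.
  by apply: contrapT => Kw; apply: nKw; split => //; exact: Vl.
move=> ufin ule; split => //; apply: le_trans ule _.
by rewrite lerD2l ler_wpM2l// mulr_ge0// M0.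
Qed.

End slutsky.

(** * Symmetry of centered normal laws *)

Section gaussian_symmetry.
Context (d : measure_display) (T : measurableType d) (R : realType).
Variable P : probability T R.

Lemma normal_probN (s : R) (A : set R) : s != 0 -> measurable A ->
  normal_prob 0 s (-%R @^-1` A) = normal_prob 0 s A.
Proof.
move=> s0 mA; rewrite /normal_prob.
have mpdf : measurable_fun A (EFin \o normal_pdf 0 s : R -> \bar R).
  by apply: measurable_funTS; apply/measurable_EFinP; exact: measurable_normal_pdf.
have pdf0 : {in A, forall x, 0 <= (EFin \o normal_pdf 0 s : R -> \bar R) x}%E.
  by move=> x _; rewrite lee_fin normal_pdf_ge0.
have mN : measurable_fun setT (-%R : measurableTypeR R -> measurableTypeR R).
  exact: oppr_measurable.
transitivity (\int[lebesgue_measure]_(x in -%R @^-1` A)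
    ((EFin \o normal_pdf 0 s) \o (-%R : measurableTypeR R -> measurableTypeR R)) x)%E.
  by apply: eq_integral => x _ /=; rewrite !normal_pdfE// /normal_fun !subr0 sqrrN.
rewrite -(ge0_integral_pushforward mN)//=.
by apply: eq_measure_integral => //= B mB _; exact: lebesgue_measureN.
Qed.

Lemma centered_normal_even (Y : T -> R) (phi : R -> R) (M : R) :
  measurable_fun setT Y -> centered_normal P Y ->
  measurable_fun setT phi -> (forall x, `|phi x| <= M) ->
  (\int[P]_w (phi (- Y w))%:E = \int[P]_w (phi (Y w))%:E)%E.
Proof.
move=> mY [s s0 Ys] mphi phiM.
have mN : measurable_fun setT (fun w => - Y w).
  by apply: (measurableT_comp _ mY); exact: oppr_measurable.
pose Y1 : {mfun T >-> R} := HB.pack Y (isMeasurableFun.Build _ _ _ _ Y mY).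
pose Y2 : {mfun T >-> R} := HB.pack (fun w => - Y w)
  (isMeasurableFun.Build _ _ _ _ (fun w => - Y w) mN).
have mphiE : measurable_fun setT (EFin \o phi) by exact/measurable_EFinP.
have i1 : P.-integrable setT ((EFin \o phi) \o Y1).
  apply: (@bounded_integrable _ _ _ P (phi \o Y) M) => [|x]; last exact: phiM.
  exact: (measurableT_comp mphi mY).
have i2 : P.-integrable setT ((EFin \o phi) \o Y2).
  apply: (@bounded_integrable _ _ _ P (fun w => phi (- Y w)) M) => [|x]; last exact: phiM.
  exact: (measurableT_comp mphi mN).
transitivity (\int[distribution P Y2]_y (EFin \o phi) y)%E.
  by rewrite integral_distribution.
transitivity (\int[distribution P Y1]_y (EFin \o phi) y)%E; last first.
  by rewrite integral_distribution.
apply: eq_measure_integral => A mA _; rewrite /distribution /pushforward.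
have mNA : measurable (-%R @^-1` A : set R).
  by rewrite -[_ @^-1` _]setTI; exact: oppr_measurable.
transitivity (P (Y @^-1` (-%R @^-1` A))) => //.
transitivity (P (Y @^-1` A)) => //.
rewrite !Ys//; case: ifPn => [_|sn]; last exact: normal_probN.
rewrite !diracE (_ : (0 \in -%R @^-1` A) = (0 \in A))//.
by apply/idP/idP; rewrite !inE /= oppr0.
Qed.

End gaussian_symmetry.

(** * Trigonometric polynomials and the Stone-Weierstrass theorem *)

Section trigonometric_polynomials.
Context (R : realType) (S : choiceType).
Implicit Types (u v : {uniform S -> R} -> R) (z : {uniform S -> R}) (l : seq (R * S)).

Definition lincomb l (z : {uniform S -> R}) : R := \sum_(p <- l) p.1 * z p.2.

Definition opp_seq l : seq (R * S) := [seq (- p.1, p.2) | p <- l].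

Lemma lincomb_cat l1 l2 z : lincomb (l1 ++ l2) z = lincomb l1 z + lincomb l2 z.
Proof. by rewrite /lincomb big_cat. Qed.

Lemma lincomb_opp l z : lincomb (opp_seq l) z = - lincomb l z.
Proof.
by rewrite /lincomb big_map -sumrN; apply: eq_bigr => p _; rewrite mulNr.
Qed.

Lemma lincombN l z : lincomb l (fun s => - z s) = - lincomb l z.
Proof. by rewrite /lincomb -sumrN; apply: eq_bigr => p _; rewrite mulrN. Qed.

(** The frequencies are finite families [l] of weighted coordinates, so that these
functions are the trigonometric polynomials in finitely many coordinates. *)
Inductive trig_poly : ({uniform S -> R} -> R) -> Prop :=
| trig_cos l : trig_poly (fun z => cos (lincomb l z))
| trig_sin l : trig_poly (fun z => sin (lincomb l z))
| trig_add u v : trig_poly u -> trig_poly v -> trig_poly (fun z => u z + v z)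
| trig_scale a u : trig_poly u -> trig_poly (fun z => a * u z).

Lemma trig_eq u v : u =1 v -> trig_poly u -> trig_poly v.
Proof. by move=> /funext->. Qed.

Lemma trig_cst a : trig_poly (cst a).
Proof.
apply: trig_eq (trig_scale a (trig_cos [::])) => z.
by rewrite /lincomb big_nil cos0 mulr1.
Qed.

(** By the product-to-sum formulas, products of sines and cosines are linear
combinations of sines and cosines of sums and differences of frequencies. *)
Lemma trig_mul u v : trig_poly u -> trig_poly v -> trig_poly (fun z => u z * v z).
Proof.
have cc l1 l2 : trig_poly (fun z => cos (lincomb l1 z) * cos (lincomb l2 z)).
  apply: trig_eq (trig_scale 2^-1 (trig_add (trig_cos (l1 ++ l2))
    (trig_cos (l1 ++ opp_seq l2)))) => z.
  by rewrite !lincomb_cat lincomb_opp !cosD cosN sinN; field.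
have ss l1 l2 : trig_poly (fun z => sin (lincomb l1 z) * sin (lincomb l2 z)).
  apply: trig_eq (trig_scale 2^-1 (trig_add (trig_cos (l1 ++ opp_seq l2))
    (trig_scale (-1) (trig_cos (l1 ++ l2))))) => z.
  by rewrite !lincomb_cat lincomb_opp !cosD cosN sinN; field.
have sc l1 l2 : trig_poly (fun z => sin (lincomb l1 z) * cos (lincomb l2 z)).
  apply: trig_eq (trig_scale 2^-1 (trig_add (trig_sin (l1 ++ l2))
    (trig_sin (l1 ++ opp_seq l2)))) => z.
  by rewrite !lincomb_cat lincomb_opp !sinD cosN sinN; field.
move=> tu tv; elim: tu => {u}[l1|l1|u1 u2 _ IH1 _ IH2|a u _ IH].
- elim: tv => {v}[l2|l2|v1 v2 _ IH1 _ IH2|a v _ IH] //.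
  + by apply: trig_eq (sc l2 l1) => z; rewrite mulrC.
  + by apply: trig_eq (trig_add IH1 IH2) => z; rewrite mulrDr.
  + by apply: trig_eq (trig_scale a IH) => z; rewrite mulrCA.
- elim: tv => {v}[l2|l2|v1 v2 _ IH1 _ IH2|a v _ IH] //.
  + by apply: trig_eq (trig_add IH1 IH2) => z; rewrite mulrDr.
  + by apply: trig_eq (trig_scale a IH) => z; rewrite mulrCA.
- by apply: trig_eq (trig_add IH1 IH2) => z; rewrite mulrDl.
- by apply: trig_eq (trig_scale a IH) => z; rewrite mulrA.
Qed.

Lemma trig_bounded u : trig_poly u -> exists M, forall z, `|u z| <= M.
Proof.
elim=> {u}[l|l|u v _ [M uM] _ [N vN]|a u _ [M uM]].
- by exists 1 => z; rewrite ler_norml cos_geN1 cos_le1.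
- by exists 1 => z; rewrite ler_norml sin_geN1 sin_le1.
- by exists (M + N) => z; rewrite (le_trans (ler_normD _ _))// lerD.
- by exists (`|a| * M) => z; rewrite normrM ler_wpM2l.
Qed.

Lemma lincomb_continuous l : continuous (lincomb l).
Proof.
move=> z; apply/continuous_uniformP; elim: l => [|p l IH] e e0.
  by exists 1 => // y _; rewrite /lincomb !big_nil subrr normr0 ltW.
have e2 : 0 < e / 2 by rewrite divr_gt0.
have [r r0 lr] := IH _ e2.
have p0 : 0 < `|p.1| + 1 by rewrite ltr_wpDl.
exists (Num.min r (e / 2 / (`|p.1| + 1))); first by rewrite lt_min r0 divr_gt0.
move=> y yz; rewrite /lincomb !big_cons opprD addrACA [leRHS]splitr.
rewrite (le_trans (ler_normD _ _))// lerD//; last first.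
  by apply: lr => s; apply: le_trans (yz s) _; rewrite ge_min lexx.
rewrite -mulrBr normrM (le_trans (ler_wpM2l _ (yz _)))//.
rewrite (@le_trans _ _ ((`|p.1| + 1) * (e / 2 / (`|p.1| + 1))))//.
  apply: ler_pM => //; first by rewrite le_min !ltW// divr_gt0.
    by rewrite lerDl.
  by rewrite ge_min lexx orbT.
by rewrite mulrC divfK// lt0r_neq0.
Qed.

Lemma trig_continuous u : trig_poly u -> continuous u.
Proof.
elim=> {u}[l|l|u v _ cu _ cv|a u _ cu] z.
- exact: (continuous_comp (@lincomb_continuous l z) (@continuous_cos R _)).
- exact: (continuous_comp (@lincomb_continuous l z) (@continuous_sin R _)).
- exact: (continuousD (cu z) (cv z)).
- exact: (continuousM (@cst_continuous _ R a z) (cu z)).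
Qed.

End trigonometric_polynomials.

Section uniform_closure.
Context (R : realType) (S : choiceType).
Local Notation Z := {uniform S -> R}.
Implicit Types (u v h : Z -> R) (K : set Z).

Definition trig_closure u : Prop := forall e : R, 0 < e ->
  exists2 a, trig_poly a & forall z, `|u z - a z| <= e.

Lemma trig_closure_poly u : trig_poly u -> trig_closure u.
Proof. by move=> tu e e0; exists u => // z; rewrite subrr normr0 ltW. Qed.

Lemma trig_closure_add u v : trig_closure u -> trig_closure v ->
  trig_closure (fun z => u z + v z).
Proof.
move=> cu cv e e0; have e2 : 0 < e / 2 by rewrite divr_gt0.
have [a ta ua] := cu _ e2; have [b tb vb] := cv _ e2.
exists (fun z => a z + b z); first exact: trig_add.
move=> z; rewrite opprD addrACA [leRHS]splitr.
by rewrite (le_trans (ler_normD _ _))// lerD.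
Qed.

Lemma trig_closure_scale c u : trig_closure u -> trig_closure (fun z => c * u z).
Proof.
move=> cu e e0; have c0 : 0 < `|c| + 1 by rewrite ltr_wpDl.
have [a ta ua] := cu _ (divr_gt0 e0 c0).
exists (fun z => c * a z); first exact: trig_scale.
move=> z; rewrite -mulrBr normrM -(divfK (lt0r_neq0 c0) e) mulrC.
by apply: ler_pM => //; rewrite lerDl.
Qed.

(** The classical monotone iteration for the square root of [x ^+ 2]: polynomials
in [x ^+ 2] that increase to the absolute value, uniformly on [[-1, 1]]. *)
Fixpoint abs_approx (k : nat) (x : R) : R :=
  if k is k'.+1 then abs_approx k' x + (x ^+ 2 - abs_approx k' x ^+ 2) / 2 else 0.

(** For [p] between 0 and [t = `|x|], the gap [d = t - p] becomes
[d * (1 - (t + p) / 2)], at most [d * (1 - d / 2)]; and this map sends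
[2 / k.+2%:R] below [2 / k.+3%:R]. *)
Lemma abs_approxP k x : `|x| <= 1 ->
  0 <= abs_approx k x <= `|x| /\ `|x| - abs_approx k x <= 2 / k.+2%:R.
Proof.
move=> x1; elim: k => [|k [/andP[p0 px] pk]] /=.
  by rewrite lexx normr_ge0 subr0 divff.
rewrite -[x ^+ 2]real_normK ?num_real//.
set t := `|x| in x1 px pk *; set p := abs_approx k x in p0 px pk *.
have m0 : (0 : R) < k.+2%:R by rewrite ltr0n.
have m2 : (2 : R) <= k.+2%:R by rewrite ler_nat.
have -> : k.+3%:R = k.+2%:R + 1 :> R by rewrite -natr1.
set m := k.+2%:R in m0 m2 pk *.
have [c cm] : exists c, c * m = 1 by exists m^-1; rewrite mulVf// gt_eqF.
have c0 : 0 < c by rewrite -(pmulr_lgt0 _ m0) cm.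
have mV : m^-1 = c by rewrite -[LHS]mul1r -cm mulfK// gt_eqF.
rewrite mV in pk; split; first by apply/andP; split; nra.
rewrite ler_pdivlMr; last by lra.
have d1 : t - p <= 1 by lra.
have c1 : c * 2 <= 1 by nra.
have : (t - p) * (1 - (t - p) / 2) <= 2 * c * (1 - c) by nra.
have : t - (p + (t ^+ 2 - p ^+ 2) / 2) <= (t - p) * (1 - (t - p) / 2) by nra.
move=> h1 h2; have h3 := le_trans h1 h2.
rewrite (le_trans (ler_wpM2r _ h3))//; first by lra.
have -> : 2 * c * (1 - c) * (m + 1) = 2 * (1 - c ^+ 2) + 2 * (c * m - 1) * (1 - c).
  by ring.
by rewrite cm; nra.
Qed.

Lemma trig_closure_abs u : trig_closure u -> trig_closure (fun z => `|u z|).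
Proof.
move=> cu e e0; have e2 : 0 < e / 2 by rewrite divr_gt0.
have [a ta ua] := cu _ e2; have [M aM] := trig_bounded ta.
(* [abs_approxP] needs values in [[-1, 1]]. *)
pose C := `|M| + 1; have C0 : 0 < C by rewrite ltr_wpDl.
have aC z : `|C^-1 * a z| <= 1.
  rewrite normrM gtr0_norm ?invr_gt0// mulrC ler_pdivrMr// mul1r.
  by rewrite (le_trans (aM z))// (le_trans (ler_norm M))// lerDl.
have [k ke] : exists k : nat, 2 / k.+2%:R <= e / 2 / C.
  have eC : 0 < e / 2 / C / 2 by rewrite !divr_gt0.
  have [k _ H] := near_infty_natSinv_lt (PosNum eC).
  exists k; rewrite mulrC -ler_pdivlMr//.
  apply: le_trans (ltW (H k (leqnn k))); rewrite lef_pV2 ?posrE ?ltr0n//.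
  by rewrite ler_nat.
have tk j : trig_poly (fun z => abs_approx j (C^-1 * a z)).
  elim: j => [|j IH]; first exact: (trig_cst S 0).
  apply: (trig_eq _ (trig_add IH (trig_scale 2^-1 (trig_add
    (trig_mul (trig_scale C^-1 ta) (trig_scale C^-1 ta))
    (trig_scale (-1) (trig_mul IH IH)))))) => z /=.
  by rewrite !expr2; ring.
exists (fun z => C * abs_approx k (C^-1 * a z)); first exact: trig_scale.
move=> z; rewrite [leRHS]splitr.
rewrite -(subrK `|a z| `|u z|) -addrA (le_trans (ler_normD _ _))// lerD//.
  by apply: le_trans (ua z); exact: ler_dist_dist.
have [/andP[_ p1] p2] := abs_approxP k (aC z).
have -> : `|a z| = C * `|C^-1 * a z|.
  by rewrite normrM gtr0_norm ?invr_gt0// mulVKf// gt_eqF.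
rewrite -mulrBr normrM gtr0_norm// ger0_norm ?subr_ge0// mulrC -ler_pdivlMr//.
exact: le_trans p2 ke.
Qed.

Lemma trig_closure_eq u v : u =1 v -> trig_closure u -> trig_closure v.
Proof. by move=> /funext->. Qed.

Lemma trig_closure_max u v : trig_closure u -> trig_closure v ->
  trig_closure (fun z => Num.max (u z) (v z)).
Proof.
move=> cu cv; apply: (trig_closure_eq _ (trig_closure_scale 2^-1
  (trig_closure_add (trig_closure_add cu cv)
    (trig_closure_abs (trig_closure_add cu (trig_closure_scale (-1) cv)))))) => z.
by rewrite mulN1r maxr_absE mulrC.
Qed.

Lemma trig_closure_min u v : trig_closure u -> trig_closure v ->
  trig_closure (fun z => Num.min (u z) (v z)).
Proof.
move=> cu cv; apply: (trig_closure_eq _ (trig_closure_scale (-1) (trig_closure_max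
  (trig_closure_scale (-1) cu) (trig_closure_scale (-1) cv)))) => z.
by rewrite !mulN1r -oppr_min opprK.
Qed.

Lemma trig_closure_continuous u : trig_closure u -> continuous u.
Proof.
move=> cu z; apply/continuous_uniformP => e e0.
have e4 : 0 < e / 4 by rewrite divr_gt0.
have [a /trig_continuous/(_ z)/continuous_uniformP/(_ _ e4)[r r0 ar] ua] := cu _ e4.
exists r => // y /ar; have := ua y; have := ua z.
by rewrite !ler_norml => /andP[? ?] /andP[? ?] /andP[? ?]; apply/andP; split; lra.
Qed.

(** Two distinct functions differ at a coordinate; the sine of a small multiple
of this coordinate separates them. *)
Lemma trig_closure_interpolate h (x y : Z) :
  exists2 u, trig_closure u & u x = h x /\ u y = h y.
Proof.
have [->|xy] := pselect (x = y).
  by exists (cst (h y)) => //; apply/trig_closure_poly/trig_cst.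
have [s xys] : exists s, x s <> y s.
  apply: contrapT => nxy; apply/xy/funext => s.
  by apply: contrapT => xys; apply: nxy; exists s.
pose q := (1 + `|x s| + `|y s|)^-1.
have q0 : 0 < 1 + `|x s| + `|y s| by rewrite !ltr_pwDl ?normr_ge0.
pose k (z : Z) := sin (lincomb [:: (q, s)] z).
have lE z : lincomb [:: (q, s)] z = q * z s by rewrite /lincomb big_seq1.
have ik (t : R) : `|t| <= `|x s| + `|y s| -> q * t \in `[- (pi / 2), pi / 2].
  move=> tq; have : `|q * t| <= 1.
    rewrite normrM gtr0_norm ?invr_gt0// mulrC ler_pdivrMr// mul1r.
    by rewrite -addrA (le_trans tq)// lerDr.
  rewrite ler_norml in_itv/= => /andP[? ?].
  by have := @pi_ge2 R => ?; apply/andP; split; lra.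
have kxy : k x - k y != 0.
  rewrite subr_eq0; apply/eqP; rewrite /k !lE => /sin_inj.
  move=> /(_ (ik _ _) (ik _ _)) h'; apply: xys.
  have /mulfI : q != 0 by rewrite gt_eqF ?invr_gt0.
  by apply; apply: h'; rewrite ?lerDl ?lerDr.
exists (fun z => (h x - h y) / (k x - k y) * (k z - k y) + h y).
  apply: trig_closure_poly; apply: (trig_eq _ (trig_add (trig_scale ((h x - h y) / (k x - k y))
    (trig_add (trig_sin [:: (q, s)]) (trig_cst S (- k y)))) (trig_cst S (h y)))) => z.
  by [].
by split; [rewrite divfK// subrK|rewrite subrr mulr0 add0r].
Qed.

(** Dini's argument: along a directed family of continuous functions, pointwise
domination improves to uniform domination on compact sets. *)
Lemma compact_directed (D : set (Z -> R)) K h (e : R) :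
  compact K -> continuous h -> 0 < e -> D !=set0 ->
  (forall u, D u -> continuous u) ->
  (forall u v, D u -> D v -> exists2 w, D w & forall z, u z <= w z /\ v z <= w z) ->
  (forall y, K y -> exists2 u, D u & h y <= u y) ->
  exists2 u, D u & forall y, K y -> h y - e <= u y.
Proof.
move=> /compact_near_coveringP Kc ch e0 [v0 Dv0] Dc Dmax Kh.
pose B v := [set u | D u /\ forall z, v z <= u z].
have FF : Filter (filter_from D B).
  apply: filter_from_filter; first by exists v0.
  move=> u v Du Dv; have [w Dw uvw] := Dmax _ _ Du Dv.
  exists w => // u' [Du' wu']; split; split => // z; apply: le_trans (wu' z).
    by have [] := uvw z.
  by have [] := uvw z.
have [|v Dv /(_ v)] := Kc _ _ (fun u y => h y - e <= u y) FF.
  move=> y /Kh[v Dv hv]; have e2 : 0 < e / 2 by rewrite divr_gt0.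
  have /continuous_uniformP/(_ _ e2)[r1 r10 vr] := Dc _ Dv y.
  have /continuous_uniformP/(_ _ e2)[r2 r20 hr] := ch y.
  exists ([set y' : Z | forall s, `|y' s - y s| <= Num.min r1 r2], B v).
    split; last by exists v.
    by apply: near_uniform; rewrite lt_min r10.
  move=> [y' u] [/= yy' [_ vu]].
  have : `|v y' - v y| <= e / 2.
    by apply: vr => s; rewrite (le_trans (yy' s))// ge_min lexx.
  have : `|h y' - h y| <= e / 2.
    by apply: hr => s; rewrite (le_trans (yy' s))// ge_min lexx orbT.
  rewrite !ler_norml => /andP[? ?] /andP[? ?]; have := vu y'; lra.
by move=> H; exists v => //; exact: H.
Qed.

(** Functions of the closure that agree with [h] at a given point [x] can be chosen
above [h - e / 2] on [K] by taking maxima, and then below [h + e / 2] by taking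
minima over [x]. The truncation at [M] and [- M] controls the approximation off
[K] as well: there the law of a Radon process has small mass, but the integral is
small only if the integrand is bounded independently of [K]. *)
Lemma stone_weierstrass K h (M e : R) :
  compact K -> continuous h -> (forall z, `|h z| <= M) -> 0 < e ->
  exists2 a, trig_poly a &
    (forall z, `|a z| <= M + e) /\ forall z, K z -> `|a z - h z| <= e.
Proof.
move=> cK ch hM e0; have e2 : 0 < e / 2 by rewrite divr_gt0.
have below x : exists2 u, trig_closure u /\ (forall y, K y -> h y - e / 2 <= u y) & u x = h x.
  have [||u v [cu ux] [cv vx]|y _|u [cu ux] hu] := @compact_directed
      [set u | trig_closure u /\ u x = h x] K h (e / 2) cK ch e2.
  - by have [u cu [ux _]] := trig_closure_interpolate h x x; exists u.
  - by move=> u [/trig_closure_continuous].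
  - exists (fun z => Num.max (u z) (v z)); last by move=> z; rewrite !le_max !lexx orbT.
    by split; [exact: trig_closure_max|rewrite ux vx maxxx].
  - by have [u cu [ux uy]] := trig_closure_interpolate h x y; exists u; rewrite ?uy.
  by exists u.
(* Minima are maxima of opposites, so the second step is the first one applied to
   the opposite functions. *)
have [|||||u [cu hu] uh] := @compact_directed
    [set u | trig_closure (fun z => - u z) /\ forall y, K y -> h y - e / 2 <= - u y]
    K (fun z => - h z) (e / 2) cK _ e2.
- by move=> z; exact: (continuousN (ch z)).
- have [u [cu hu] _] := below (fun=> 0).
  exists (fun z => - u z); split; last by move=> y /hu; rewrite opprK.
  by apply: trig_closure_eq cu => z; rewrite opprK.
- move=> u [/trig_closure_continuous cu _] z.
  have -> : u = fun z => - - u z by apply/funext => y; rewrite opprK.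
  exact: (continuousN (cu z)).
- move=> u v [cu hu] [cv hv]; exists (fun z => Num.max (u z) (v z)).
    split; last by move=> y Ky; rewrite oppr_max le_min hu// hv.
    by apply: trig_closure_eq (trig_closure_min cu cv) => z; rewrite oppr_max.
  by move=> z; rewrite !le_max !lexx orbT.
- move=> y _; have [u [cu hu] uy] := below y; exists (fun z => - u z); last by rewrite uy.
  split; last by move=> x /hu; rewrite opprK.
  by apply: trig_closure_eq cu => z; rewrite opprK.
pose b z := Num.max (- M) (Num.min M (- u z)).
have cM c : trig_closure (cst c) by apply/trig_closure_poly/trig_cst.
have [a ta ba] : exists2 a, trig_poly a & forall z, `|b z - a z| <= e / 2.
  by apply: (trig_closure_max (cM _) (trig_closure_min (cM _) cu)).
have M0 : 0 <= M by apply: le_trans (hM (fun=> 0)).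
exists a => //; split => [z|z Kz]; have := ba z; rewrite !ler_norml => /andP[ab1 ab2].
  have : - M <= b z <= M.
    by rewrite le_max lexx/= ge_max ge_min lexx/= andbT; lra.
  by move=> /andP[? ?]; apply/andP; split; lra.
have : h z - e / 2 <= b z <= h z + e / 2.
  have := hM z; rewrite ler_norml => /andP[h1 h2].
  have := hu z Kz; have := uh z Kz => uz1 uz2.
  rewrite le_max le_min ge_max ge_min; apply/andP; split.
    by apply/orP; right; apply/andP; split; lra.
  by apply/andP; split; [lra|apply/orP; right; lra].
by move=> /andP[? ?]; apply/andP; split; lra.
Qed.

End uniform_closure.

(** * A centered Gaussian process with a Radon law is symmetric *)

Section reflection.
Context (d : measure_display) (T : measurableType d) (R : realType).
Variable P : probability T R.
Variable S : choiceType.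

Lemma upper_expectation_integrable (f : T -> \bar R) :
  P.-integrable setT f -> upper_expectation P f = (\int[P]_w f w)%E.
Proof.
move=> iF; apply/eqP; rewrite eq_le; apply/andP; split.
  by apply: ereal_inf_lbound; exists f.
by apply: le_ereal_inf_tmp => _ [U [iU fU] <-]; exact: le_integral.
Qed.

Lemma integral_close (f k : T -> R) (M e : R) (N : set T) :
  measurable_fun setT f -> measurable_fun setT k ->
  (forall w, `|f w| <= M) -> (forall w, `|k w| <= M) ->
  measurable N -> 0 <= e -> (forall w, ~ N w -> `|f w - k w| <= e) ->
  `|fine (\int[P]_w (f w)%:E)%E - fine (\int[P]_w (k w)%:E)%E|
    <= e + 2 * M * fine (P N).
Proof.
move=> mf mk fM kM mN e0 fk.
have [_] := upper_expectation_close P mk kM fM mN e0 fk.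
by rewrite upper_expectation_integrable//; exact: (bounded_integrable P mf fM).
Qed.

Lemma gaussian_lincomb (V : T -> {uniform S -> R}) (l : seq (R * S)) :
  centered_gaussian_process P V ->
  measurable_fun setT (fun w => lincomb l (V w)) /\
  centered_normal P (fun w => lincomb l (V w)).
Proof.
move=> [mV gV]; split.
  by apply: measurable_sum => p; exact: measurable_funM.
have -> : (fun w => lincomb l (V w)) =
    (fun w => \sum_(i < size l) (tnth (in_tuple l) i).1 * V w (tnth (in_tuple l) i).2).
  by apply/funext => w; rewrite /lincomb big_tnth.
exact: gV.
Qed.

(** Cosines are even, and sines of the projections of [V] have symmetric laws. *)
Lemma trig_poly_reflect (V : T -> {uniform S -> R}) (a : {uniform S -> R} -> R) :
  centered_gaussian_process P V -> trig_poly a ->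
  [/\ measurable_fun setT (fun w => a (V w)),
      measurable_fun setT (fun w => a (fun s => - V w s)) &
      fine (\int[P]_w (a (fun s => - V w s))%:E)%E = fine (\int[P]_w (a (V w))%:E)%E].
Proof.
move=> gV; have mcos := continuous_measurable_fun (@continuous_cos R).
have msin := continuous_measurable_fun (@continuous_sin R).
have lin b b' c (z : T -> {uniform S -> R}) : trig_poly b -> trig_poly b' ->
    measurable_fun setT (fun w => b (z w)) -> measurable_fun setT (fun w => b' (z w)) ->
    fine (\int[P]_w (b (z w) + c * b' (z w))%:E)%E =
    fine (\int[P]_w (b (z w))%:E)%E + c * fine (\int[P]_w (b' (z w))%:E)%E.
  move=> /trig_bounded[M bM] /trig_bounded[M' bM'] mb mb'.
  have ib := bounded_integrable P mb (fun w => bM (z w)).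
  have ib' := bounded_integrable P mb' (fun w => bM' (z w)).
  under eq_integral do rewrite EFinD EFinM.
  rewrite integralD//; last exact: integrableZl.
  rewrite integralZl// fineD ?fineM//.
  - exact: (integrable_fin_num measurableT ib').
  - exact: (integrable_fin_num measurableT ib).
  - by apply: fin_numM => //; exact: (integrable_fin_num measurableT ib').
elim=> {a} [l|l|u v tu [mu mu' uE] tv [mv mv' vE]|c u tu [mu mu' uE]].
- have [ml _] := gaussian_lincomb l gV.
  have cE w : cos (lincomb l (fun s => - V w s)) = cos (lincomb l (V w)).
    by rewrite lincombN cosN.
  split; first exact: (measurableT_comp mcos ml).
    by under eq_fun do rewrite cE; exact: (measurableT_comp mcos ml).
  by under eq_integral do rewrite cE.
- have [ml nl] := gaussian_lincomb l gV.
  have mNl : measurable_fun setT (fun w => - lincomb l (V w)).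
    by apply: (measurableT_comp _ ml); exact: oppr_measurable.
  split; first exact: (measurableT_comp msin ml).
    by under eq_fun do rewrite lincombN; exact: (measurableT_comp msin mNl).
  under eq_integral do rewrite lincombN.
  congr fine; apply: (@centered_normal_even _ _ _ P _ sin 1) => //.
  by move=> x; rewrite ler_norml sin_geN1 sin_le1.
- split; [exact: measurable_funD|exact: measurable_funD|].
  have := lin u v 1 (fun w => (fun s => - V w s)) tu tv mu' mv'.
  have := lin u v 1 V tu tv mu mv.
  under eq_integral do rewrite mul1r.
  by move=> ->; under eq_integral do rewrite mul1r; move=> ->; rewrite uE vE.
- split; [exact: measurable_funM|exact: measurable_funM|].
  have := lin (cst 0) u c (fun w => (fun s => - V w s)) (trig_cst S 0) tu (measurable_cst _) mu'.
  have := lin (cst 0) u c V (trig_cst S 0) tu (measurable_cst _) mu.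
  under eq_integral do rewrite /= add0r.
  by move=> ->; under eq_integral do rewrite /= add0r; move=> ->; rewrite uE.
Qed.

(** The one-dimensional projections of [V] are symmetric, so the expectations
of trigonometric polynomials do not change under reflection. These polynomials
are dense on compact sets, and a Radon law lives, up to a small mass, on a
compact set. *)
Lemma gaussian_reflect (V : T -> {uniform S -> R}) (h : {uniform S -> R} -> R) :
  centered_gaussian_process P V -> radon_law P V ->
  bounded_real h -> {within @linf R S, continuous h} ->
  ('E_P[fun w => h (fun s => (- V w s)%R)] = 'E_P[fun w => h (V w)])%E.
Proof.
move=> gV [Vl Vm Vt] [M hM] /continuous_linf_patch.
set h0 := h \_ (@linf R S) => ch.
have hE z : linf z -> h z = h0 z by move=> zl; rewrite /h0 patchE mem_set.
have NVl w : @linf R S (fun s => - V w s).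
  by have [C VC] := Vl w; exists C => s; rewrite normrN.
have M0 : 0 <= M by apply: le_trans (hM (fun=> 0)).
have h0M z : `|h0 z| <= M.
  by rewrite /h0 patchE; case: ifP => // _; rewrite normr0.
rewrite !expectation_integral.
under eq_integral do rewrite (hE _ (NVl _)).
under [RHS]eq_integral do rewrite (hE _ (Vl _)).
have cN : continuous (fun z : {uniform S -> R} => (fun s => - z s) : {uniform S -> R}).
  move=> z A /nbhs_uniformP[e e0 eA]; apply/nbhs_uniformP; exists e => // y yz.
  by apply: eA => s; rewrite -opprD normrN.
have NVm B : borel_uniform B ->
    measurable ((fun w => (fun s => - V w s) : {uniform S -> R}) @^-1` B).
  by move=> bB; exact: (Vm _ (continuous_borel cN bB)).
have mh : measurable_fun setT (fun w => h0 (V w)) by exact: measurable_continuous_comp.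
have mhN : measurable_fun setT (fun w => h0 (fun s => - V w s)).
  exact: (measurable_continuous_comp NVm).
have f1 := integrable_fin_num measurableT (bounded_integrable P mh (fun w => h0M _)).
have f2 := integrable_fin_num measurableT (bounded_integrable P mhN (fun w => h0M _)).
rewrite -[LHS]fineK// -[RHS]fineK//; congr EFin.
apply/eqP; rewrite -subr_eq0 -normr_le0.
apply/ler_addgt0Pr => e' e'0; rewrite add0r.
have [e [e0 e1 ee]] : exists e : R, [/\ 0 < e, e <= 1 & 2 * (e + 2 * (M + 1) * e) <= e'].
  pose c := 2 * (1 + 2 * (M + 1)); have c0 : 0 < c by rewrite /c; lra.
  exists (Num.min 1 (e' / c)); split; first by rewrite lt_min ltr01 divr_gt0.
    by rewrite ge_min lexx.
  rewrite [leLHS](_ : _ = Num.min 1 (e' / c) * c); last by rewrite /c; ring.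
  by rewrite -ler_pdivlMr// ge_min lexx orbT.
have bT : borel_uniform [set: {uniform S -> R}].
  by apply: sub_sigma_algebra; exact: openT.
have [K [cK _ PK]] := Vt _ bT e e0.
(* The approximation has to hold at both [V w] and its opposite. *)
pose K2 := K `|` (fun z : {uniform S -> R} => (fun s => - z s) : {uniform S -> R}) @` K.
have cK2 : compact K2.
  by apply: compactU => //; apply: continuous_compact => //; exact: continuous_subspaceT.
have [a ta [aM ah]] := stone_weierstrass cK2 ch h0M e0.
have [ma maN aE] := trig_poly_reflect gV ta.
have mN : measurable (V @^-1` (setT `\` K)).
  by rewrite setTD; apply: Vm; exact: compact_borel.
have h0M1 z : `|h0 z| <= M + 1 by rewrite (le_trans (h0M z))// lerDl.
have aM1 z : `|a z| <= M + 1 by rewrite (le_trans (aM z))// lerD2l.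
have PN : fine (P (V @^-1` (setT `\` K))) <= e.
  by rewrite -lee_fin fineK ?ltW// fin_num_measure.
have PN2 : e + 2 * (M + 1) * fine (P (V @^-1` (setT `\` K))) <= e + 2 * (M + 1) * e.
  by rewrite lerD2l ler_wpM2l//; lra.
have onK (z : {uniform S -> R}) : K2 z -> `|h0 z - a z| <= e.
  by move=> /ah; rewrite distrC.
have Kw w : ~ (V @^-1` (setT `\` K)) w -> K (V w).
  by move=> nK; apply: contrapT => nKw; apply: nK.
have d1 := @integral_close (fun w => h0 (V w)) (fun w => a (V w)) (M + 1) e _ mh ma
  (fun w => h0M1 _) (fun w => aM1 _) mN (ltW e0) (fun w nw => onK _ (or_introl (Kw w nw))).
have d2 := @integral_close (fun w => h0 (fun s => - V w s)) (fun w => a (fun s => - V w s))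
  (M + 1) e _ mhN maN (fun w => h0M1 _) (fun w => aM1 _) mN (ltW e0)
  (fun w nw => onK _ (or_intror (ex_intro2 _ _ _ (Kw w nw) erefl))).
move: (le_trans d1 PN2) (le_trans d2 PN2); rewrite aE !ler_norml.
by move=> /andP[? ?] /andP[? ?]; apply/andP; split; lra.
Qed.

End reflection.

(** * Inversion of a distribution function *)

Section quantiles.
Context {R : realType}.
Implicit Types F f z : R -> R.

Lemma quantileP F (a : R) :
  {homo F : x y / x <= y} -> (forall x, F y @[y --> x^'+] --> F x) ->
  (exists x, a <= F x) -> (exists x, F x < a) ->
  a <= F (quantile F a) /\ forall y, y < quantile F a -> F y < a.
Proof.
move=> Fm Fr [x1 ax1] [x0 ax0]; rewrite /quantile.
have hA : has_inf [set x | a <= F x].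
  split; first by exists x1.
  exists x0 => x /= ax; rewrite leNgt; apply/negP => xx0.
  by move: (lt_le_trans ax0 ax); rewrite ltNge Fm// ltW.
set q := inf _; split; last first.
  move=> y yq; rewrite ltNge; apply/negP => ay.
  by move: yq; rewrite ltNge ge_inf//; case: hA.
rewrite leNgt; apply/negP => Fqa.
have [y [qy Fy]] : exists y, q < y /\ F y < a.
  apply: (@filter_ex _ (q^'+)); apply: filterI; first exact: nbhs_right_gt.
  exact: cvgr_lt (Fr q) _ Fqa.
have [x ax xy] : exists2 x, a <= F x & x < y.
  have yq0 : 0 < y - q by rewrite subr_gt0.
  by have [x ax] := inf_adherent yq0 hA; rewrite addrC subrK => xy; exists x.
by move: (lt_le_trans Fy ax); rewrite ltNge Fm// ltW.
Qed.

Lemma density_derivable F f : is_density F f -> continuous f ->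
  forall x : R, is_derive x (1 : R) F (f x).
Proof.
move=> [mf f0 FE] cf x.
have FR : F = fun y => (\int[lebesgue_measure]_(t in [set` Interval -oo%O (BRight y)]) f t)%R.
  by apply/funext => y; rewrite /Rintegral -FE.
have x1 : x < x + 1 by rewrite ltrDl.
have If : lebesgue_measure.-integrable [set` Interval -oo%O (BRight (x + 1))] (EFin \o f).
  apply/integrableP; split; first by apply/measurable_EFinP; exact: measurable_funTS.
  under eq_integral do rewrite /= ger0_norm//.
  by rewrite -FE ltry.
have [|dF Ff] := continuous_FTC1 x1 If _ (cf x); first by rewrite ltNyr.
rewrite FR; apply: DeriveDef; first exact: dF.
by rewrite -derive1E; exact: Ff.
Qed.

Lemma derive_mvt F f : (forall x : R, is_derive x (1 : R) F (f x)) ->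
  forall x y, exists2 c, `|c - x| <= `|y - x| & F y - F x = f c * (y - x).
Proof.
move=> dF.
have cF A : {within A, continuous F}.
  apply: continuous_subspaceT => x; apply: differentiable_continuous.
  by apply/derivable1_diffP; case: (dF x).
move=> x y; have [xy|yx|->] := ltgtP x y.
- have [c] := MVT xy (fun x _ => dF x) (cF _).
  rewrite in_itv/= => /andP[xc cy] E; exists c => //.
  by rewrite !gtr0_norm ?subr_gt0// lerD2r ltW.
- have [c] := MVT yx (fun x _ => dF x) (cF _).
  rewrite in_itv/= => /andP[yc cx] E; exists c.
    by rewrite !ltr0_norm ?subr_lt0// lerN2 lerD2r ltW.
  by rewrite -opprB E -mulrN opprB.
- by exists y; rewrite ?subrr// mulr0.
Qed.

(** One path of the empirical process: [s] is the square root of the sample size,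
[Fn] the empirical distribution function, [x] its quantile at level [a] and [z]
the path of the limit. The inequalities satisfied by [Fn] at [x] and on the left
of [x], together with the continuity of [F] and [z], pinch [s * (F x - a) + z x]
between [- eta] and [eta]. So [F x - a] is at most [(M + 1) / s], which is less
than the increment [c * th] of [F] over a distance [th]; this localises [x] near
[tau], where the mean value theorem converts the increment of [F] into an
increment of its argument. *)
Lemma quantile_inversion F Fn f z (a s c th rho M ep eta x tau : R) :
  continuous F -> continuous z -> {homo F : x y / x <= y} ->
  (forall x y, exists2 c, `|c - x| <= `|y - x| & F y - F x = f c * (y - x)) ->
  F tau = a -> 0 < s -> 0 < c -> 0 < th -> 0 <= ep -> eta <= 1 ->
  (forall u, `|u - tau| <= th -> c <= f u /\ `|f u - f tau| <= ep) ->
  (forall y, `|F y - F tau| <= rho -> `|z y - z tau| <= ep) ->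
  (forall y, `|z y| <= M) ->
  (forall y, `|s * (Fn y - F y) - z y| <= eta) ->
  a <= Fn x -> (forall y, y < x -> Fn y < a) ->
  M + 1 <= s * rho -> M + 1 < s * (c * th) ->
  `|s * (x - tau) * f tau + z tau| <= eta + ep + ep * ((M + 1) / c).
Proof.
move=> cF cz Fm mvt Ftau s0 c0 th0 ep0 eta1 fth zrho zM Fnz ax yx srho sth.
(* The values of [Fn] at [x] and on the left of [x] give the two bounds. *)
have lo : - eta <= s * (F x - a) + z x.
  have := Fnz x; rewrite ler_norml => /andP[_].
  by have := ler_wpM2l (ltW s0) ax; rewrite !mulrBr; lra.
have hi : s * (F x - a) + z x <= eta.
  rewrite leNgt; apply/negP => hx.
  pose k y := s * (F y - a) + z y.
  have ck : k y @[y --> x^'-] --> k x.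
    apply: cvg_at_left_filter; apply: cvgD; last exact: cz.
    by apply: cvgM; [exact: cvg_cst|apply: cvgB; [exact: cF|exact: cvg_cst]].
  have [y [yltx ky]] : exists y, y < x /\ eta < k y.
    apply: (@filter_ex _ (x^'-)); apply: filterI; first exact: nbhs_left_lt.
    exact: cvgr_gt ck _ hx.
  have := Fnz y; rewrite ler_norml => /andP[? _].
  by have := ler_wpM2l (ltW s0) (ltW (yx y yltx)); move: ky; rewrite /k !mulrBr; lra.
have zMx := zM x; rewrite ler_norml in zMx; case/andP: zMx => zM1 zM2.
have sF : s * `|F x - a| <= M + 1.
  rewrite -[s in s * `|_|]gtr0_norm// -normrM ler_norml; apply/andP; split; lra.
have Dth : `|x - tau| <= th.
  rewrite ler_norml; apply/andP; split; rewrite leNgt; apply/negP => bad.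
    have [u] := mvt tau (tau - th); have -> : tau - th - tau = - th by ring.
    rewrite normrN (gtr0_norm th0) => /fth[cu _]; rewrite Ftau => E.
    have Fx : F x <= F (tau - th) by apply: Fm; lra.
    have h := ler_wpM2r (ltW th0) cu; rewrite mulrN in E.
    have : c * th <= `|F x - a| by rewrite distrC (le_trans _ (ler_norm _))//; lra.
    by move=> /(ler_wpM2l (ltW s0)); lra.
  have [u] := mvt tau (tau + th); have -> : tau + th - tau = th by ring.
  rewrite (gtr0_norm th0) => /fth[cu _]; rewrite Ftau => E.
  have Fx : F (tau + th) <= F x by apply: Fm; lra.
  have h := ler_wpM2r (ltW th0) cu.
  have : c * th <= `|F x - a| by rewrite (le_trans _ (ler_norm _))//; lra.
  by move=> /(ler_wpM2l (ltW s0)); lra.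
have [u ux E] := mvt tau x; rewrite Ftau in E.
have [cu fu] := fth u (le_trans ux Dth).
have sD : s * `|x - tau| <= (M + 1) / c.
  rewrite ler_pdivlMr// (le_trans _ sF)// E normrM -mulrA ler_pM2l// mulrC.
  by rewrite ler_wpM2r// (le_trans cu)// ler_norm.
have zx : `|z x - z tau| <= ep.
  by apply: zrho; rewrite Ftau -(ler_pM2l s0) (le_trans sF).
have -> : s * (x - tau) * f tau + z tau =
    (s * (F x - a) + z x) - (z x - z tau) - s * (x - tau) * (f u - f tau).
  by rewrite E; ring.
rewrite (le_trans (ler_normB _ _))// lerD//.
  rewrite (le_trans (ler_normB _ _))// lerD//.
  by rewrite ler_norml lo hi.
rewrite normrM mulrC ler_pM// normrM (gtr0_norm s0)//.
Qed.

End quantiles.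

(** * Distribution functions and paths of the limit process *)

Section distribution_functions.
Context (d : measure_display) (T : measurableType d) (R : realType).
Context (P : probability T R) (E : Type).

(** A finite sample has no point in a small interval on the right of [x], so the
empirical distribution function is constant there. *)
Lemma empirical_df_quantile (Xs : nat -> E -> {RV P >-> R}) n w t (a : R) :
  (0 < n)%N -> 0 < a < 1 ->
  let Fn := empirical_df Xs n w t in
  a <= Fn (quantile Fn a) /\ forall y, y < quantile Fn a -> Fn y < a.
Proof.
move=> n0 /andP[a0 a1] Fn; have nR : (0 : R) < n%:R by rewrite ltr0n.
have nV : n%:R^-1 * n%:R = 1 :> R by rewrite mulVf// gt_eqF.
apply: quantileP => [x y xy|x||].
- rewrite /Fn /empirical_df ler_wpM2l ?invr_ge0 ?(ltW nR)//; apply: ler_sum => i _.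
  by rewrite ler_nat; case: (leP (Xs i t w) x) => // /le_trans/(_ xy) ->.
- apply: cvg_near_cst.
  have near_i (i : 'I_n) : \forall y \near x^'+, (Xs i t w <= y) = (Xs i t w <= x).
    have [Xx|xX] := leP (Xs i t w) x.
      by apply: filterS (nbhs_right_gt x) => y xy; rewrite (le_trans Xx)// ltW.
    by apply: filterS (nbhs_right_lt xX) => y yX; rewrite leNgt yX.
  apply: filterS (filter_forall _ near_i) => y Ey.
  by rewrite /Fn /empirical_df; congr (_ * _); apply: eq_bigr => i _; rewrite Ey.
- have [x Xx] : exists x, forall i : 'I_n, Xs i t w <= x.
    have near_i (i : 'I_n) : \forall x \near +oo, Xs i t w <= x.
      by apply: nbhs_pinfty_ge; exact: num_real.
    exact: filter_ex (filter_forall _ near_i).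
  exists x; rewrite /Fn /empirical_df (eq_bigr (fun=> 1)) => [|i _]; last by rewrite Xx.
  by rewrite big_const_ord iter_addr_0 nV ltW.
- have [x xX] : exists x, forall i : 'I_n, x < Xs i t w.
    have near_i (i : 'I_n) : \forall x \near -oo, x < Xs i t w.
      by apply: nbhs_ninfty_lt; exact: num_real.
    exact: filter_ex (filter_forall _ near_i).
  exists x; rewrite /Fn /empirical_df big1 ?mulr0// => i _.
  by rewrite leNgt xX.
Qed.

Lemma df_quantile (X : E -> {RV P >-> R}) t (a : R) :
  continuous (df X t) -> 0 < a < 1 -> df X t (quantile (df X t) a) = a.
Proof.
move=> cF /andP[a0 a1].
have Fm : {homo df X t : x y / x <= y}.
  by move=> x y xy; rewrite fine_le ?fin_num_measure// cdf_nondecreasing.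
have [||aF Fa] := quantileP Fm (fun x => cvg_at_right_filter (cF x)) (a := a).
- have /fine_cvgP[_ /cvgr_gt/(_ _ a1) h] := cvg_cdfy1 (X t).
  by have [x /ltW] := filter_ex h; exists x.
- have /fine_cvgP[_ /cvgr_lt/(_ _ a0) h] := cvg_cdfNy0 (X t).
  by have [x] := filter_ex h; exists x.
apply/eqP; rewrite eq_le aF andbT leNgt; apply/negP => h.
set q := quantile _ a in h Fa.
have [y [yq]] : exists y, y < q /\ a < df X t y.
  apply: (@filter_ex _ (q^'-)); apply: filterI; first exact: nbhs_left_lt.
  exact: cvgr_gt (cvg_at_left_filter (cF q)) _ h.
by rewrite ltNge ltW// Fa.
Qed.

End distribution_functions.

Section intrinsic_distance.
Context (d0 d : measure_display) (T0 : measurableType d0) (T : measurableType d).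
Context (R : realType) (P : probability T0 R) (Q : probability T R).

Lemma integral_sqrB (Y Z : {RV Q >-> R}) (yy yz zz : R) :
  ('E_Q[fun w => (Y w * Y w)%R] = yy%:E)%E ->
  ('E_Q[fun w => (Y w * Z w)%R] = yz%:E)%E ->
  ('E_Q[fun w => (Z w * Z w)%R] = zz%:E)%E ->
  ('E_Q[fun w => ((Y w - Z w) ^+ 2)%R] = (yy - 2 * yz + zz)%:E)%E.
Proof.
rewrite !expectation_integral => Eyy Eyz Ezz.
have mM (U W : {RV Q >-> R}) : measurable_fun setT (EFin \o (fun w => U w * W w)).
  by apply/measurable_EFinP; exact: measurable_funM.
have isq (U : {RV Q >-> R}) (u : R) : (\int[Q]_w (U w * U w)%:E = u%:E)%E ->
    Q.-integrable setT (EFin \o (fun w => U w * U w)).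
  move=> Eu; apply/integrableP; split; first exact: mM.
  under eq_integral do rewrite /= ger0_norm -?expr2 ?sqr_ge0//.
  by under eq_integral do rewrite expr2; rewrite Eu ltry.
have iyy := isq _ _ Eyy; have izz := isq _ _ Ezz.
have iyz : Q.-integrable setT (EFin \o (fun w => Y w * Z w)).
  apply: (le_integrable measurableT (mM Y Z) _ (integrableD measurableT iyy izz)) => w _.
  rewrite -[leLHS]/(`|Y w * Z w|%:E) -[leRHS]/(`|Y w * Y w + Z w * Z w|%:E) lee_fin.
  rewrite (ger0_norm (addr_ge0 _ _)) -?expr2 ?sqr_ge0//.
  by rewrite ler_norml; apply/andP; split; nra.
have i2 : Q.-integrable setT (fun w => (- 2)%:E * (EFin \o (fun w => Y w * Z w)%R) w)%E.
  exact: integrableZl.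
transitivity (\int[Q]_w ((EFin \o (fun w => Y w * Y w)%R) w +
   ((- 2)%:E * (EFin \o (fun w => Y w * Z w)%R) w + (EFin \o (fun w => Z w * Z w)%R) w)))%E.
  by apply: eq_integral => w _ /=; rewrite -EFinM -!EFinD; congr EFin; ring.
rewrite integralD//; last exact: integrableD.
rewrite integralD// integralZl// Eyy Eyz Ezz -EFinM -!EFinD; congr EFin; ring.
Qed.

(** The covariance gives the squared distance [D - D ^+ 2], where [D] is the
absolute value of [df X t x - df X t y]. *)
Lemma L2_dist_df (E : choiceType) (X : E -> {RV P >-> R}) (G : E * R -> {RV Q >-> R}) :
  (forall s x t y, ('E_Q[fun w => (G (s, x) w * G (t, y) w)%R])%E =
      (fine (P [set w | X s w <= x /\ X t w <= y]) - df X s x * df X t y)%:E) ->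
  forall t x y, L2_dist Q (fun w p => G p w) (t, x) (t, y) <=
    Num.sqrt `|df X t x - df X t y|.
Proof.
move=> cov t x y.
have PE a b : fine (P [set w | X t w <= a /\ X t w <= b]) = df X t (Num.min a b).
  rewrite /df /cdf /distribution /pushforward; congr (fine (P _)).
  apply/seteqP; split=> w /=; rewrite in_itv/= le_min; first by move=> [-> ->].
  by move=> /andP.
have := integral_sqrB (cov t x t x) (cov t x t y) (cov t y t y).
rewrite /L2_dist !PE !minxx => ->; apply: ler_wsqrtr => /=.
have Fm a b : a <= b -> df X t a <= df X t b.
  by move=> ab; rewrite fine_le ?fin_num_measure// cdf_nondecreasing.
have := ler_norm (df X t x - df X t y); have := ler_norm (df X t y - df X t x).
rewrite distrC; have [/Fm|/ltW/Fm] := leP x y; nra.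
Qed.

End intrinsic_distance.

Section tightness.
Context (d : measure_display) (T : measurableType d) (R : realType).
Variable Q : probability T R.

(** Off an event of small probability the paths lie in a compact set, on which
boundedness and continuity hold uniformly. The compact set may contain functions
that are not paths; continuity passes to a neighbourhood of such a function from
a path near it, if there is one. *)
Lemma radon_uniform_paths (S : choiceType) (V : T -> {uniform S -> R}) (e : R) :
  radon_law Q V -> L2_unif_continuous_paths Q V -> 0 < e ->
  exists A : set T, [/\ measurable A, (Q (~` A) < e%:E)%E,
    exists M : R, forall w s, A w -> `|V w s| <= M &
    forall r : R, 0 < r -> exists2 rho : R, 0 < rho &
      forall w p q, A w -> L2_dist Q V p q < rho -> `|V w p - V w q| <= r].
Proof.
move=> [Vl Vm Vt] Vc e0.
have bl : borel_uniform (@linf R S) by apply: sub_sigma_algebra; exact: linf_open.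
have [K [cK Kl PK]] := Vt _ bl e e0.
have VK : ~` (V @^-1` K) = V @^-1` (@linf R S `\` K).
  by apply/seteqP; split => w /=; [split|case].
exists (V @^-1` K); split.
- rewrite -[_ @^-1` _]setCK; apply: measurableC; rewrite VK.
  rewrite setDE preimage_setI; apply: measurableI; first exact: Vm.
  by apply: Vm; exact: compact_borel.
- by rewrite VK.
- have [z /Kl[C zC]|r r0 H] := @compact_uniform_small _ _ K
    (fun r z => forall s, `|z s| <= r^-1) cK; last first.
    by exists r^-1 => w s Kw; exact: H.
  have C0 : 0 < `|C| + 1 by rewrite ltr_wpDl.
  exists (`|C| + 1)^-1; first by rewrite invr_gt0.
  exists 1 => // y r' yz r'0 r'r s.
  rewrite (@le_trans _ _ (`|C| + 1))//.
    rewrite -(subrK (z s) (y s)) addrC (le_trans (ler_normD _ _))// lerD//.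
    by rewrite (le_trans (zC s))// ler_norm.
  by rewrite -[leLHS]invrK lef_pV2// posrE invr_gt0.
- move=> r r0; have r3 : 0 < r / 3 by rewrite divr_gt0.
  have [z Kz|rho rho0 H] := @compact_uniform_small _ _ K (fun rho z => forall w, z = V w ->
    forall p q, L2_dist Q V p q < rho -> `|z p - z q| <= r) cK; last first.
    by exists rho => // w p q Kw; exact: (H (V w)).
  (* Five terms: the modulus of the path near [z], at most [r / 3], and four
     distances of at most [r / 9]. *)
  have [[w0 zw0]|nw] := pselect (exists w0, forall s, `|V w0 s - z s| <= r / 9).
    have [rho rho0 H] := Vc w0 _ r3.
    exists rho => //; exists (r / 9); first by rewrite divr_gt0.
    move=> y r' yz r'0 r'rho w _ p q pq.
    have := H p q (lt_le_trans pq r'rho).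
    move: (zw0 p) (zw0 q) (yz p) (yz q); rewrite ltr_norml !ler_norml.
    by move=> /andP[? ?] /andP[? ?] /andP[? ?] /andP[? ?] /andP[? ?]; apply/andP; split; lra.
  exists 1 => //; exists (r / 9); first by rewrite divr_gt0.
  by move=> y r' yz _ _ w yw; exfalso; apply: nw; exists w; rewrite -yw.
Qed.

End tightness.

(** * The empirical quantile process *)

Section reflected_limit.
Context (d d' : measure_display) (T : measurableType d) (T' : measurableType d').
Context (R : realType) (P : probability T R) (Q : probability T' R).

Lemma centered_gaussian_image (S S' : Type) (V : T' -> S' -> R) (g : T -> T')
    (phi : S -> S') (c : S -> R) :
  measurable_fun setT g -> (forall A, measurable A -> P (g @^-1` A) = Q A) ->
  centered_gaussian_process Q V ->
  centered_gaussian_process P (fun w s => c s * V (g w) (phi s)).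
Proof.
move=> mg Pg [mV gV]; split=> [s|n s b].
  by apply: measurable_funM => //; exact: (measurableT_comp (mV (phi s)) mg).
have [sg sg0 Vsg] := gV n (fun i => phi (s i)) (fun i => b i * c (s i)).
pose W w := \sum_(i < n) b i * c (s i) * V w (phi (s i)).
have mW : measurable_fun setT W.
  by apply: measurable_sum => i; exact: measurable_funM.
have -> : (fun w => \sum_(i < n) b i * (c (s i) * V (g w) (phi (s i)))) = W \o g.
  by apply/funext => w; apply: eq_bigr => i _; rewrite mulrA.
exists sg => // A mA; rewrite -Vsg// -Pg//.
by rewrite -[_ @^-1` _]setTI; exact: mW.
Qed.

(** If [Vn + V] vanishes in the limit then [Vn] converges to [- V], which has
the same law as [V]. *)
Lemma clt_linf_reflect (S : choiceType) (Vn : nat -> T -> S -> R) (V : T -> S -> R) :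
  centered_gaussian_process P V -> radon_law P (V : T -> {uniform S -> R}) ->
  outer_cvg0 P (fun n w s => Vn n w s + V w s) -> clt_linf P Vn V.
Proof.
move=> gV rV VnV; split=> // h bh ch; rewrite -gaussian_reflect//.
have rNV : radon_law P (fun w => (fun s => - V w s) : {uniform S -> R}).
  have N1 (s : S) : `|(-1 : R)| <= 1 by rewrite normrN1.
  have := radon_law_image id (@measurable_id _ T setT) (fun A _ => erefl (P A)) N1 rV.
  by under eq_fun do under eq_fun do rewrite mulN1r.
apply: (slutsky rNV) => //.
have -> : (fun n w s => Vn n w s - - V w s) = (fun n w s => Vn n w s + V w s).
  by apply/funext => n; apply/funext => w; apply/funext => s; rewrite opprK.
exact: VnV.
Qed.

End reflected_limit.

Lemma uniform_modulus (R : realType) (E : Type) (f : E -> R -> R) :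
  nnsup [set y | exists t u v, `|u - v| <= delta /\ y = (`|f t u - f t v|)%:E]
    @[delta --> (0 : R)^'+] --> 0%E ->
  forall ep : R, 0 < ep -> exists2 delta : R, 0 < delta &
    forall t u v, `|u - v| <= delta -> `|f t u - f t v| <= ep.
Proof.
move=> /fine_cvgP[hfin /cvgrPdist_lt hlim] ep ep0.
have [delta [[dfin dlim] d0]] := filter_ex (filterI (filterI hfin (hlim _ ep0)) (nbhs_right_gt 0)).
exists delta => // t u v uv; rewrite -lee_fin.
rewrite sub0r normrN in dlim.
have := ltW (le_lt_trans (ler_norm _) dlim); rewrite -lee_fin fineK//.
apply: le_trans.
rewrite /nnsup le_max; apply/orP; right; apply: ereal_sup_ubound.
by exists t, u, v.
Qed.

Section empirical_quantiles.
Context (R : realType) (E : choiceType) (d0 d d' : measure_display).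
Context (Omega0 : measurableType d0) (Omega : measurableType d)
  (OmegaHat : measurableType d').
Context (P : probability Omega0 R) (Q : probability Omega R)
  (Phat : probability OmegaHat R).
Variables (X : E -> {RV P >-> R}) (Xs : nat -> E -> {RV Q >-> R}).
Variables (G : (E * R)%type -> {RV Q >-> R}) (g : nat -> OmegaHat -> Omega).
Variable f : E -> R -> R.
Hypothesis (hclt : empirical_clt X Xs G) (hrep : as_representation Phat X Xs G g).
Hypothesis hF : forall t x y, x < y -> df X t x < df X t y.
Hypothesis hf : forall t, is_density (df X t) (f t).
Hypothesis hfc : forall ep : R, 0 < ep -> exists2 delta : R, 0 < delta &
    forall t u v, `|u - v| <= delta -> `|f t u - f t v| <= ep.

Let tau t alpha := quantile (df X t) alpha.

Lemma density_continuous t : continuous (f t).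
Proof.
move=> x; apply/cvgrPdist_le => e /hfc[r r0 fr]; near=> y; apply: fr.
by rewrite ltW//; near: y; exact: nbhsx_ballx.
Unshelve. all: by end_near. Qed.

Lemma df_derivable t x : is_derive (x : R) (1 : R) (df X t) (f t x).
Proof. exact: density_derivable (hf t) (@density_continuous t) x. Qed.

Lemma df_continuous t : continuous (df X t).
Proof.
move=> x; apply: differentiable_continuous; apply/derivable1_diffP.
by case: (df_derivable t x).
Qed.

(** The distance between [(t, x)] and [(t, y)] tends to 0 as [y] tends to [x], since
the distribution function is continuous. *)
Lemma path_continuous w t : continuous (fun x => G (t, x) w).
Proof.
have [_ cov Gc] := hclt.
move=> x; apply/cvgrPdist_le => e e0.
have [r r0 Gr] := Gc w e e0.
have r20 : 0 < (r / 2) ^+ 2 by rewrite exprn_gt0// divr_gt0.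
have /cvgrPdist_le/(_ _ r20) := @df_continuous t x.
apply: filterS => y Fxy; apply/ltW/Gr.
apply: le_lt_trans (L2_dist_df cov t x y) _.
apply: le_lt_trans (ler_wsqrtr Fxy) _.
by rewrite sqrtr_sqr ger0_norm ?divr_ge0 ?ltW// ltr_pdivrMr// ltr_pMr// ltr1n.
Qed.

(** All the constants in the inversion of one path can be chosen uniformly in
[t] and [alpha], on an event whose probability is close to 1. *)
Lemma quantile_process_close (a b theta c : R) : 0 < a -> b < 1 ->
  0 < theta -> 0 < c ->
  (forall t alpha x, a <= alpha <= b -> `|x - tau t alpha| <= theta -> c <= f t x) ->
  outer_cvg0 Phat (fun n w (p : E * set_type (`[a, b]%classic : set R)) =>
    Num.sqrt n%:R * (quantile (empirical_df Xs n (g n w) p.1) (\val p.2)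
                     - tau p.1 (\val p.2))
    * f p.1 (tau p.1 (\val p.2)) + G (p.1, tau p.1 (\val p.2)) (g 0%N w)).
Proof.
move=> a0 b1 theta0 c0 fc e r e0 r0.
have [[_ radG _] cov Gc] := hclt; have [mg _ Pg hae] := hrep.
have e2 : 0 < e / 2 by rewrite divr_gt0.
have [A [mA QA [M GM] Gmod]] := radon_uniform_paths radG Gc e2.
(* The error [eta + ep + ep * ((M + 1) / c)] of the inversion is at most [r]. *)
pose eta : R := Num.min 1 (r / 2).
have eta0 : 0 < eta by rewrite lt_min ltr01 divr_gt0.
have C0 : 0 < 1 + (`|M| + 1) / c by rewrite ltr_pwDl// divr_ge0// ?addr_ge0// ltW.
pose ep := r / 2 / (1 + (`|M| + 1) / c).
have ep0 : 0 < ep by rewrite !divr_gt0.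
have [delta delta0 fdelta] := hfc ep0.
pose th := Num.min theta delta.
have th0 : 0 < th by rewrite lt_min theta0.
have [r1 r10 Gr1] := Gmod _ ep0.
(* An increment of [F] of at most [rho] is a distance of at most [r1 / 2]. *)
pose rho := (r1 / 2) ^+ 2; have rho0 : 0 < rho by rewrite exprn_gt0// divr_gt0.
have cth0 : 0 < c * th by rewrite mulr_gt0.
(* A lower bound for the square root of the sample size. *)
pose B := Num.max ((`|M| + 1) / rho) ((`|M| + 1) / (c * th)).
have B0 : 0 <= B.
  by rewrite le_max divr_ge0// ?addr_ge0// ltW.
apply: filterS2 (nbhs_infty_gtr (B ^+ 2)) (outer_cvg0_ae hae e2 eta0) => n nB [A' [mA' PA' nuG]].
have n0 : (0 < n)%N by rewrite -(ltr0n R) (le_lt_trans _ nB)// sqr_ge0.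
have s0 : 0 < Num.sqrt n%:R :> R by rewrite sqrtr_gt0 ltr0n.
have Bs : B < Num.sqrt n%:R.
  by rewrite -(ger0_norm B0) -sqrtr_sqr ltr_sqrt// ltr0n.
have mgA : measurable (g 0%N @^-1` A) by rewrite -[_ @^-1` _]setTI; exact: mg.
have PgA : (Phat (~` (g 0%N @^-1` A)) < (e / 2)%:E)%E.
  by rewrite preimage_setC Pg//; exact: measurableC.
exists (g 0%N @^-1` A `&` A'); split; first exact: measurableI.
  rewrite setCI; apply: le_lt_trans (measureU2 _ _ _) _; try exact: measurableC.
  by rewrite [e]splitr EFinD; apply: lteD.
move=> w [t [alpha alphaI]] [Aw A'w] /=.
have /andP[a1 a2] : a <= alpha <= b by move: alphaI; rewrite inE/= in_itv.
have alpha01 : 0 < alpha < 1.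
  by rewrite (lt_le_trans a0 a1) (le_lt_trans a2 b1).
have [ax yx] := empirical_df_quantile Xs (g n w) t n0 alpha01.
have M1 : `|M| + 1 = (`|M| + 1) / rho * rho by rewrite divfK// gt_eqF.
have M2 : `|M| + 1 = (`|M| + 1) / (c * th) * (c * th) by rewrite divfK// gt_eqF.
apply: le_trans (@quantile_inversion R (df X t) (empirical_df Xs n (g n w) t) (f t)
  (fun x => G (t, x) (g 0%N w)) alpha (Num.sqrt n%:R) c th rho `|M| ep eta _ _
  (@df_continuous t) (@path_continuous _ t) _ (derive_mvt (df_derivable t))
  (df_quantile (@df_continuous t) alpha01) s0 c0 th0 (ltW ep0) _ _ _ _ _ ax yx _ _) _.
- by move=> x y; rewrite le_eqVlt => /predU1P[->//|/hF/ltW].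
- by rewrite ge_min lexx.
- move=> u; rewrite le_min => /andP[u1 u2]; split; last exact: fdelta.
  by apply: fc u1; rewrite a1.
- move=> y Fy; apply: Gr1 => //; apply: le_lt_trans (L2_dist_df cov t _ _) _.
  apply: le_lt_trans (ler_wsqrtr Fy) _.
  by rewrite sqrtr_sqr ger0_norm ?divr_ge0 ?ltW// ltr_pdivrMr// ltr_pMr// ltr1n.
- by move=> y; rewrite (le_trans (GM (g 0%N w) (t, y) Aw))// ler_norm.
- by move=> y; exact: (nuG w (t, y) A'w).
- by rewrite M1 ler_wpM2r ?ltW//; apply: le_lt_trans Bs; rewrite le_max lexx.
- by rewrite M2 ltr_pM2r//; apply: le_lt_trans Bs; rewrite le_max lexx orbT.
have -> : eta + ep + ep * ((`|M| + 1) / c) = eta + r / 2.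
  by rewrite -[X in _ = _ + X](divfK (lt0r_neq0 C0)) -/ep; ring.
by rewrite [leRHS]splitr lerD2r ge_min lexx orbT.
Qed.

End empirical_quantiles.

Theorem theorem2 (R : realType) (E : choiceType)
    (d0 d d' : measure_display)
    (Omega0 : measurableType d0) (Omega : measurableType d)
    (OmegaHat : measurableType d')
    (P : probability Omega0 R) (Q : probability Omega R)
    (Phat : probability OmegaHat R)
    (D : set (E -> R)) (X : E -> {RV P >-> R})
    (hD : {ae P, forall w, D (sample_path X w)})
    (Xs : nat -> E -> {RV Q >-> R}) (hXs : iid_copies X Xs)
    (G : (E * R)%type -> {RV Q >-> R}) (hclt : empirical_clt X Xs G)
    (g : nat -> OmegaHat -> Omega)
    (hrep : as_representation Phat X Xs G g)
    (f : E -> R -> R)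
    (hF : forall t x y, x < y -> df X t x < df X t y)
    (hf : forall t, is_density (df X t) (f t))
    (hfcont : nnsup [set y | exists t u v,
                 `|u - v| <= delta /\ y = (`|f t u - f t v|)%:E]
                @[delta --> (0 : R)^'+] --> 0%E)
    (hfpos : forall a b : R, 0 < a -> a <= b -> b < 1 ->
       exists2 theta : R, 0 < theta &
         (0 < ereal_inf [set y | (exists t alpha x,
            [/\ alpha \in `[a, b],
                `|x - quantile (df X t) alpha| <= theta &
                y = (f t x)%:E])%R])%E)
    (a b : R) (ha : 0 < a) (hab : a <= b) (hb : b < 1) :
  let I := set_type (`[a, b]%classic : set R) in
  let tau (t : E) (alpha : R) := quantile (df X t) alpha in
  let Fhat n (w : OmegaHat) t x := empirical_df Xs n (g n w) t x in
  let tauhat n w (t : E) (alpha : R) := quantile (Fhat n w t) alpha in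
  let Ghat (w : OmegaHat) t x := G (t, x) (g 0%N w) in
  [/\ cvg_in_probability0 Phat (fun n => cover_fun Phat (fun w =>
        sup_norm (fun p : (E * I)%type =>
          let t := p.1 in let alpha := \val p.2 in
          Num.sqrt n%:R * (tauhat n w t alpha - tau t alpha)
            * f t (tau t alpha) + Ghat w t (tau t alpha)))),
      clt_linf Phat
        (fun n w (p : (E * I)%type) =>
           let t := p.1 in let alpha := \val p.2 in
           Num.sqrt n%:R * (tauhat n w t alpha - tau t alpha)
             * f t (tau t alpha))
        (fun w p =>
           let t := p.1 in let alpha := \val p.2 in
           Ghat w t (tau t alpha)) &
      clt_linf Phat
        (fun n w (p : (E * I)%type) =>
           let t := p.1 in let alpha := \val p.2 in
           Num.sqrt n%:R * (tauhat n w t alpha - tau t alpha))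
        (fun w p =>
           let t := p.1 in let alpha := \val p.2 in
           Ghat w t (tau t alpha) / f t (tau t alpha))].
Proof.
move=> I tau Fhat tauhat Ghat.
have hfc := uniform_modulus hfcont.
have [theta theta0 fpos] := hfpos a b ha hab hb.
set inff := ereal_inf _ in fpos.
have [c c0 cinf] : exists2 c : R, 0 < c & (c%:E <= inff)%E.
  case: inff fpos => [c c0| _|//]; last by exists 1 => //; rewrite leey.
  by exists c.
have fc t alpha x : a <= alpha <= b -> `|x - tau t alpha| <= theta -> c <= f t x.
  move=> al xt; rewrite -lee_fin (le_trans cinf)//; apply: ereal_inf_lbound.
  by exists t, alpha, x; rewrite in_itv.
have close := quantile_process_close hclt hrep hF hf hfc ha hb theta0 c0 fc.
have [mg _ Pg _] := hrep.
have [[gaussG radG _] _ _] := hclt.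
pose phi (p : E * I) := (p.1, tau p.1 (\val p.2)).
have limit_clt (Vn : nat -> OmegaHat -> E * I -> R) (k : E * I -> R) (C : R) :
    (forall p, `|k p| <= C) ->
    outer_cvg0 Phat (fun n w p => Vn n w p + k p * G (phi p) (g 0%N w)) ->
    clt_linf Phat Vn (fun w p => k p * G (phi p) (g 0%N w)).
  move=> kC Vnk; apply: clt_linf_reflect => //.
    exact: (centered_gaussian_image phi k (mg 0%N) (Pg 0%N) gaussG).
  exact: (radon_law_image phi (mg 0%N) (Pg 0%N) kC radG).
split.
- exact: outer_cvg0_cover close.
- have := limit_clt (fun n w p => Num.sqrt n%:R *
    (tauhat n w p.1 (\val p.2) - tau p.1 (\val p.2)) * f p.1 (tau p.1 (\val p.2)))
    (fun=> 1) 1.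
  have -> : (fun w p => 1 * G (phi p) (g 0%N w)) = (fun w p => G (phi p) (g 0%N w)).
    by apply/funext => w; apply/funext => p; rewrite mul1r.
  apply; first by move=> p; rewrite normr1.
  have -> : (fun (n : nat) w p => Num.sqrt n%:R *
    (tauhat n w p.1 (\val p.2) - tau p.1 (\val p.2)) * f p.1 (tau p.1 (\val p.2)) +
    1 * G (phi p) (g 0%N w)) = (fun (n : nat) w p => Num.sqrt n%:R *
    (tauhat n w p.1 (\val p.2) - tau p.1 (\val p.2)) * f p.1 (tau p.1 (\val p.2)) +
    G (phi p) (g 0%N w)).
    by apply/funext => n; apply/funext => w; apply/funext => p; rewrite mul1r.
  exact: close.
- pose k (p : E * I) := (f p.1 (tau p.1 (\val p.2)))^-1.
  have fp (p : E * I) : c <= f p.1 (tau p.1 (\val p.2)).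
    case: p => t [alpha al]; apply: (fc _ alpha); last by rewrite subrr normr0 ltW.
    by move: al; rewrite inE/= in_itv.
  have kC p : `|k p| <= c^-1.
    have f0 := lt_le_trans c0 (fp p).
    by rewrite gtr0_norm ?invr_gt0// lef_pV2// posrE.
  have := limit_clt (fun n w p => Num.sqrt n%:R *
    (tauhat n w p.1 (\val p.2) - tau p.1 (\val p.2))) k c^-1 kC.
  have -> : (fun w p => k p * G (phi p) (g 0%N w)) =
      (fun w p => G (phi p) (g 0%N w) / f p.1 (tau p.1 (\val p.2))).
    by apply/funext => w; apply/funext => p; rewrite mulrC.
  apply; have := outer_cvg0_scale id kC close.
  congr (outer_cvg0 _ _); apply/funext => n; apply/funext => w; apply/funext => p /=.
  rewrite mulrDr mulrC mulfK ?gt_eqF//; exact: lt_le_trans c0 (fp p).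
Qed.
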